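(* Assume that $H$ is infinite dimensional and that the embedding $H_{\frac12}\hookrightarrow H$ is compact. Let $(i\omega_n)$ be the sequence of eigenvalues, with $|\omega_n|\to+\infty$, of the operator $\begin{pmatrix}0&I\\ -A&0\end{pmatrix}$ on $H_{\frac12}\times H$, corresponding to an orthonormal basis of eigenfunctions $\begin{pmatrix}\frac{u_n}{i\omega_n}\\ u_n\end{pmatrix}$, where $u_n\in H_{\frac12}$. Then: (1) If $B\in\mathcal{L}(U,H)$, the semigroup $e^{t\mathcal{A}}$ is not exponentially stable in $\mathcal{H}$. (2) If $B\in\mathcal{L}(U,H_{-\frac12})$, the semigroup $e^{t\mathcal{A}}$ is not exponentially stable in $\mathcal{H}$ provided one of the following holds: (i) $B^*u_n=0$ for some $n\in\mathbb{N}$ (in this case the semigroup $e^{t\mathcal{A}}$ is not even strongly stable and the energy is conserved for some data); (ii) $B^*u_n\neq0$ for all $n\in\mathbb{N}$, and there exist a subsequence of $(u_n)$ (still denoted $(u_n)$) and $C>0$ such that $BB^*u_n\in H$ and $\|BB^*u_n\|_H\le C$ for every $n$.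
   Context: Let $H$ be a complex Hilbert space and $A:\mathcal{D}(A)\subset H\to H$ a self-adjoint and strictly positive operator. For $\beta\ge0$, $H_\beta=\mathcal{D}(A^\beta)$ with norm $\|z\|_\beta=\|A^\beta z\|_H$, and $H_{-\beta}=H_\beta^*$ is the dual with respect to the pivot space $H$; $A$ extends (or restricts) to a bounded operator $H_\beta\to H_{\beta-1}$ for every $\beta\in\mathbb{R}$. Let $U$ be a Hilbert space identified with its dual, $B:U\to H_{-\frac12}$ a bounded linear operator, and $B^*:H_{\frac12}\to U$ its adjoint. Let $0<\alpha<1$, $\eta\ge0$, $\gamma=\frac{2\sin(\alpha\pi)\Gamma(\frac12+1)}{\pi^{\frac12+1}}$, $p(\xi)=|\xi|^{\frac{2\alpha-1}{2}}$ ($\xi\in\mathbb{R}$). Let $V=L^2(\mathbb{R};U)$ and $\mathcal{H}=H_{\frac12}\times H\times V$ with inner product $$\langle(u_1,v_1,\varphi_1),(u_2,v_2,\varphi_2)\rangle_{\mathcal{H}}=\langle A^{\frac12}u_1,A^{\frac12}u_2\rangle_H+\langle v_1,v_2\rangle_H+\gamma\int_{\mathbb{R}}\langle\varphi_1(\xi),\varphi_2(\xi)\rangle_U\,\mathrm{d}\xi.$$ The operator $\mathcal{A}:\mathcal{D}(\mathcal{A})\subset\mathcal{H}\to\mathcal{H}$ is $$\mathcal{A}(u,v,\varphi)=\Big(v,\ -Au-\gamma B\int_{\mathbb{R}}p(\xi)\varphi(\xi)\,\mathrm{d}\xi,\ -(|\xi|^2+\eta)\varphi+p(\xi)B^*v\Big),$$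 with domain $$\mathcal{D}(\mathcal{A})=\Big\{(u,v,\varphi)\in\mathcal{H}:\ v\in H_{\frac12},\ Au+\gamma B\int_{\mathbb{R}}p(\xi)\varphi(\xi)\,\mathrm{d}\xi\in H,\ |\xi|\varphi\in L^2(\mathbb{R};U),\ -(|\xi|^2+\eta)\varphi+p(\xi)B^*v\in L^2(\mathbb{R};U)\Big\}.$$ It generates a $C_0$ semigroup of contractions $e^{t\mathcal{A}}$ on $\mathcal{H}$. Exponentially stable means $\|e^{t\mathcal{A}}\|_{\mathcal{L}(\mathcal{H})}\le Ce^{-\delta t}$ for all $t\ge0$ for some $C,\delta>0$; strongly stable means $\|e^{t\mathcal{A}}X_0\|_{\mathcal{H}}\to0$ as $t\to+\infty$ for all $X_0\in\mathcal{H}$; the energy of a solution $X(t)=e^{t\mathcal{A}}X_0$ is $\frac12\|X(t)\|_{\mathcal{H}}^2$. *)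

(* Defs.v *)
From HB Require Import structures.
From mathcomp Require Import all_boot all_order all_algebra.
From mathcomp Require Import all_classical all_reals all_analysis.
From mathcomp Require Import measurable_realfun.
From mathcomp Require Import generic_quotient ring_quotient.
From mathcomp Require Import ring lra.
From mathcomp.real_closed Require Export complex.

Set Implicit Arguments.
Unset Strict Implicit.
Unset Printing Implicit Defensive.
Import Order.TTheory GRing.Theory Num.Theory.
Import numFieldNormedType.Exports.
Local Open Scope classical_set_scope.
Local Open Scope ring_scope.
Local Open Scope complex_scope.
Local Open Scope quotient_scope.

(* The inner product is linear in its first argument and conjugate-linear in
   the second one. *)
HB.mixin Record isHilbert (R : realType) E
    of CompleteNormedModule R[i] E := {
  dot : E -> E -> R[i];
  dot_linearl : forall a x y z, dot (a *: x + y) z = a * dot x z + dot y z;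
  dotC : forall x y, dot x y = (dot y x)^*;
  dot_norm : forall x, dot x x = `|x| ^+ 2
}.

#[short(type="hilbertType")]
HB.structure Definition Hilbert (R : realType) :=
  {E of isHilbert R E & CompleteNormedModule R[i] E}.

(* The library norm of a normed module over R[i] is an element of R[i]. *)
Definition rnorm (R : realType) (E : normedModType R[i]) (x : E) : R :=
  complex.Re `|x|.

Section HilbertTheory.
Context {R : realType} {E : hilbertType R}.
Implicit Types x y z : E.

Lemma dotDl x y z : dot (x + y) z = dot x z + dot y z.
Proof. by rewrite -[x]scale1r dot_linearl scale1r mul1r. Qed.

Lemma dot0l z : dot (0 : E) z = 0.
Proof. by apply: (addIr (dot 0 z)); rewrite -dotDl !add0r. Qed.

Lemma dotZl a x z : dot (a *: x) z = a * dot x z.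
Proof. by rewrite -[a *: x]addr0 dot_linearl dot0l addr0. Qed.

End HilbertTheory.

Section CauchySchwarz.
Context {R : realType} {E : hilbertType R}.
Implicit Types x y z : E.

Lemma dotDr x y z : dot x (y + z) = dot x y + dot x z.
Proof. by rewrite dotC dotDl rmorphD /= -!dotC. Qed.

Lemma dotZr a x y : dot x (a *: y) = a^* * dot x y.
Proof. by rewrite dotC dotZl rmorphM /= -dotC. Qed.

Lemma cauchy_schwarz x y : `|dot x y| <= `|x| * `|y|.
Proof.
have [->|y0] := eqVneq y 0.
  by rewrite dotC dot0l normr0 mulr0 rmorph0 normr0.
have ny0 : 0 < `|y| ^+ 2 by rewrite exprn_gt0// normr_gt0.
pose a := dot x y / `|y| ^+ 2.
have orth : dot (x - a *: y) y = 0.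
  by rewrite -scaleNr dotDl dotZl dot_norm mulNr divfK ?subrr// gt_eqF.
have : 0 <= dot (x - a *: y) (x - a *: y).
  by rewrite dot_norm exprn_ge0.
rewrite -{2}scaleNr dotDr dotZr orth mulr0 addr0 -scaleNr dotDl dotZl dot_norm.
rewrite (dotC y x) mulNr subr_ge0 /a mulrAC ler_pdivrMr//.
rewrite -[(_^*)%C]/((dot x y)^*) => h.
rewrite -(@ler_pXn2r _ 2)// ?nnegrE ?mulr_ge0//.
by rewrite exprMn normCK.
Qed.

End CauchySchwarz.

Section Bochner.
Context d (T : measurableType d) (R : realType).
Variable mu : {measure set T -> \bar R}.
Context {E : normedModType R[i]}.
Implicit Types (l : seq (set T * E)) (f g : T -> E).

(* A simple function is given by a list of pairs (measurable set of finite
   measure, value); the sets may overlap, in which case the values add up. *)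
Definition simple_data l :=
  forall p, p \in l -> measurable p.1 /\ (mu p.1 < +oo)%E.

Definition simple_fun l (x : T) : E :=
  \sum_(p <- l) (\1_(p.1) x : R)%:C *: p.2.

Definition simple_integral l : E :=
  \sum_(p <- l) (fine (mu p.1))%:C *: p.2.

Definition strongly_measurable f :=
  exists s : nat -> seq (set T * E),
    (forall n, simple_data (s n)) /\
    (forall x, simple_fun (s n) x @[n --> \oo] --> f x).

Definition is_bochner f (w : E) :=
  strongly_measurable f /\
  exists s : nat -> seq (set T * E),
    [/\ forall n, simple_data (s n),
        (\int[mu]_x (rnorm (f x - simple_fun (s n) x))%:E)%E
          @[n --> \oo] --> 0%E
      & simple_integral (s n) @[n --> \oo] --> w].

Definition bochner_integral f : E := xget 0 [set w | is_bochner f w].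

Lemma rnorm_ge0 (x : E) : 0 <= rnorm x.
Proof. by have := normr_ge0 x; rewrite lecE => /andP[]. Qed.

Lemma rnormE (x : E) : `|x| = (rnorm x)%:C.
Proof.
rewrite /rnorm; case: `|x| (normr_ge0 x) => a b.
by rewrite lecE /= => /andP[/eqP ->].
Qed.

Lemma ler_rnormD (x y : E) : rnorm (x + y) <= rnorm x + rnorm y.
Proof. by have := ler_normD x y; rewrite !rnormE -rmorphD /= lecR. Qed.

Lemma rnormZ (a : R[i]) (x : E) : rnorm (a *: x) = complex.Re `|a| * rnorm x.
Proof.
rewrite {1}/rnorm normrZ rnormE.
by case: `|a| => ? ? /=; rewrite mulr0 subr0.
Qed.

Lemma rnormN (x : E) : rnorm (- x) = rnorm x.
Proof. by rewrite /rnorm normrN. Qed.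

Lemma ler_dist_rnorm (x y : E) : `|rnorm x - rnorm y| <= rnorm (x - y).
Proof.
have h1 : rnorm x <= rnorm (x - y) + rnorm y.
  by rewrite (le_trans _ (ler_rnormD _ _))// subrK.
have h2 : rnorm y <= rnorm (x - y) + rnorm x.
  by rewrite -[rnorm (x - y)]rnormN opprB (le_trans _ (ler_rnormD _ _))// subrK.
by rewrite ler_norml; lra.
Qed.

Lemma cvg_rnorm (u : nat -> E) (w : E) :
  u n @[n --> \oo] --> w -> rnorm (u n) @[n --> \oo] --> rnorm w.
Proof.
move=> /cvgrPdist_lt uw; apply/cvgrPdist_lt => e e0.
have ec0 : (0 : R[i]) < e%:C by rewrite ltcR.
have := uw _ ec0; apply: filterS => n.
rewrite rnormE ltcR => h.
exact: le_lt_trans (ler_dist_rnorm _ _) h.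
Qed.

Lemma measurable_rnorm_simple l (c : E) : simple_data l ->
  measurable_fun [set: T] (fun x => rnorm (c + simple_fun l x)).
Proof.
elim: l c => [|[A u] l ih] c hl.
  rewrite (_ : (fun _ => _) = cst (rnorm c)); first exact: measurable_cst.
  by apply/funext => x; rewrite /simple_fun big_nil addr0.
have [mA _] : measurable A /\ (mu A < +oo)%E.
  by apply: (hl (A, u)); rewrite inE eqxx.
have {}hl : simple_data l by move=> p pl; apply: hl; rewrite inE pl orbT.
rewrite (_ : (fun _ => _) = (fun x => if x \in A
    then rnorm (c + u + simple_fun l x) else rnorm (c + simple_fun l x))).
  apply: measurable_fun_ifT; [|exact: ih|exact: ih].
  by apply: (measurable_fun_bool true); rewrite setTI preimage_mem_true.
apply/funext => x; rewrite /simple_fun big_cons /= indicE; case: ifPn => xA.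
  by rewrite scale1r addrA.
by rewrite scale0r add0r.
Qed.

Lemma measurable_rnorm f : strongly_measurable f ->
  measurable_fun [set: T] (fun x => rnorm (f x)).
Proof.
move=> [s [hs sf]].
apply: (@measurable_fun_cvg _ _ _ _
  (fun n x => rnorm (0 + simple_fun (s n) x))).
  by move=> n; exact: measurable_rnorm_simple.
by move=> x _; apply: cvg_rnorm; under eq_fun do rewrite add0r; exact: sf.
Qed.

Lemma strongly_measurable0 : strongly_measurable (0 : T -> E).
Proof.
exists (fun=> [::]); split => // x.
by rewrite /simple_fun; under eq_fun do rewrite big_nil; exact: cvg_cst.
Qed.

Lemma strongly_measurable_lin (a : R[i]) f g : strongly_measurable f ->
  strongly_measurable g -> strongly_measurable (a *: f + g).
Proof.
move=> [s [hs sf]] [t [ht tg]].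
exists (fun n => [seq (p.1, a *: p.2) | p <- s n] ++ t n); split.
  move=> n p; rewrite mem_cat => /orP[/mapP[q qs ->]|pt]; last exact: (ht n).
  exact: (hs n q qs).
move=> x.
rewrite [X in X @ _ --> _](_ : _ =
    (fun n => a *: simple_fun (s n) x + simple_fun (t n) x)).
  by apply: cvgD; [apply: cvgZl_tmp; exact: sf|exact: tg].
apply/funext => n; rewrite /simple_fun big_cat big_map scaler_sumr /=.
by congr (_ + _); apply: eq_bigr => p _; rewrite !scalerA mulrC.
Qed.

Definition L2fun : {pred T -> E} :=
  mem [set f | strongly_measurable f /\
               (\int[mu]_x ((rnorm (f x)) ^+ 2)%:E < +oo)%E].

Lemma L2funP f : f \in L2fun <-> strongly_measurable f /\
  (\int[mu]_x ((rnorm (f x)) ^+ 2)%:E < +oo)%E.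
Proof. by split => [/set_mem|h]//; exact/mem_set. Qed.

Lemma L2fun_submod_closed : submod_closed L2fun.
Proof.
split.
  apply/L2funP; split; first exact: strongly_measurable0.
  rewrite (eq_integral (cst 0%E)) ?integral0// => x _.
  by rewrite /rnorm normr0 /= expr0n.
move=> a f g /L2funP[mf lf] /L2funP[mg lg]; apply/L2funP.
have mfg := strongly_measurable_lin a mf mg; split => //.
have mX h : strongly_measurable h ->
    measurable_fun [set: T] (fun x => (rnorm (h x) ^+ 2)%:E).
  by move=> mh; apply/measurable_EFinP; apply: measurable_funX;
    exact: measurable_rnorm.
pose b : R := 2 * complex.Re `|a| ^+ 2.
have b0 : 0 <= b by rewrite mulr_ge0// sqr_ge0.
apply: (@le_lt_trans _ _
  (\int[mu]_x (b%:E * ((rnorm (f x)) ^+ 2)%:E +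
               2%:E * ((rnorm (g x)) ^+ 2)%:E))%E).
  apply: ge0_le_integral => //.
  - by move=> x _; rewrite lee_fin sqr_ge0.
  - exact: mX.
  - by apply: emeasurable_funD; apply: measurable_funeM; exact: mX.
  move=> x _; rewrite -!EFinM -EFinD lee_fin.
  apply: (@le_trans _ _ ((complex.Re `|a| * rnorm (f x) + rnorm (g x)) ^+ 2)).
    rewrite ler_pXn2r ?nnegrE ?rnorm_ge0//; last first.
      by rewrite -rnormZ (le_trans _ (ler_rnormD (a *: f x) (g x)))// rnorm_ge0.
    by rewrite -rnormZ; exact: ler_rnormD.
  rewrite /b -subr_ge0.
  set X := complex.Re _; set Y := rnorm (f x); set Z := rnorm (g x).
  rewrite (_ : _ - _ = (X * Y - Z) ^+ 2); first exact: sqr_ge0.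
  ring.
rewrite ge0_integralD//; last 4 first.
- by move=> x _; rewrite -EFinM lee_fin mulr_ge0 ?sqr_ge0.
- by apply: measurable_funeM; exact: mX.
- by move=> x _; rewrite -EFinM lee_fin mulr_ge0 ?sqr_ge0.
- by apply: measurable_funeM; exact: mX.
rewrite !ge0_integralZl//; try exact: mX;
  try by move=> x _; rewrite lee_fin sqr_ge0.
by rewrite lte_add_pinfty// lte_mul_pinfty.
Qed.

HB.instance Definition _ :=
  GRing.isSubmodClosed.Build _ _ L2fun L2fun_submod_closed.

Record L2pre := MkL2pre { L2pre_fun :> T -> E; _ : L2pre_fun \in L2fun }.
HB.instance Definition _ := [isSub for L2pre_fun].
HB.instance Definition _ := [Choice of L2pre by <:].
HB.instance Definition _ := [SubChoice_isSubLmodule of L2pre by <:].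

Definition L2null : {pred L2pre} :=
  mem [set f : L2pre | {ae mu, forall x, f x = 0}].

Lemma L2null_zmod_closed : zmod_closed L2null.
Proof.
split; first by apply/mem_set; apply: nearW.
move=> f g /set_mem f0 /set_mem g0; apply/mem_set => /=.
move: f0 g0; apply: filterS2 => x fx gx.
suff : f x - g x = 0 by [].
by rewrite fx gx subr0.
Qed.

HB.instance Definition _ :=
  GRing.isZmodClosed.Build _ L2null L2null_zmod_closed.

Definition L2 : Type := Quotient.quot L2null.
HB.instance Definition _ := EqQuotient.on L2.
HB.instance Definition _ := GRing.Zmodule.on L2.

Definition L2scale (a : R[i]) (f : L2) : L2 := \pi_L2 (a *: repr f).

Let piP (f : L2) : {g : L2pre | f = \pi_L2 g}.
Proof. by exists (repr f); rewrite reprK. Qed.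

Let pi_scale a (f : L2pre) : \pi_L2 (a *: f) = L2scale a (\pi_L2 f).
Proof.
apply/eqP; rewrite -Quotient.idealrBE -scalerBr; apply/mem_set => /=.
have : f == repr (\pi_L2 f) %[mod L2] by rewrite reprK.
rewrite -Quotient.idealrBE => /set_mem; apply: filterS => x fx.
suff : a *: ((f - repr (\pi_L2 f)) x) = 0 by [].
by rewrite fx scaler0.
Qed.

Let L2scaleA a b (f : L2) : L2scale a (L2scale b f) = L2scale (a * b) f.
Proof. by have [g ->] := piP f; rewrite -!pi_scale scalerA. Qed.

Let L2scale1 (f : L2) : L2scale 1 f = f.
Proof. by have [g ->] := piP f; rewrite -!pi_scale scale1r. Qed.

Let L2scaleDr a : {morph L2scale a : f g / f + g}.
Proof.
move=> f g; have [{}f ->] := piP f; have [{}g ->] := piP g.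
rewrite -raddfD -!pi_scale -raddfD.
by rewrite scalerDr.
Qed.

Let L2scaleDl (f : L2) : {morph L2scale^~ f : a b / a + b}.
Proof.
by move=> a b; have [g ->] := piP f; rewrite -!pi_scale -raddfD scalerDl.
Qed.

HB.instance Definition _ := GRing.Zmodule_isLmodule.Build R[i] L2
  L2scaleA L2scale1 L2scaleDr L2scaleDl.

(* The class of f if f is square integrable, the class of 0 otherwise. *)
Definition L2class f : L2 := \pi_L2 (insubd (0 : L2pre) f).

End Bochner.

Section L2Inner.
Context d (T : measurableType d) (R : realType).
Variable mu : {measure set T -> \bar R}.
Context {E : hilbertType R}.

Definition complex_integral (f : T -> R[i]) : R[i] :=
  Rintegral mu [set: T] (fun x => complex.Re (f x)) +i*
  Rintegral mu [set: T] (fun x => complex.Im (f x)).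

Definition L2dot (f g : L2 mu (E := E)) : R[i] :=
  complex_integral (fun x => dot (repr f x) (repr g x)).

End L2Inner.

(* Partially defined operators; [papp] is only meaningful on [pdom]. *)
Record partial_op (E F : Type) :=
  PartialOp { pdom : set E; papp :> E -> F }.

Record linear_op (R : realType) (E F : lmodType R[i]) := LinearOp {
  linear_op_pop :> partial_op E F;
  pdom_submod : submod_closed (mem (pdom linear_op_pop));
  papp_linear : forall a x y,
    pdom linear_op_pop x -> pdom linear_op_pop y ->
    linear_op_pop (a *: x + y) = a *: linear_op_pop x + linear_op_pop y }.

Section SelfAdjoint.
Context {R : realType} {H : hilbertType R}.
Implicit Types A S : linear_op H H.

Definition selfadjoint A :=
  dense (pdom A) /\
  forall y z, (forall x, pdom A x -> dot (A x) y = dot x z) <->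
              (pdom A y /\ A y = z).

Definition strictly_positive A :=
  exists2 m : R, 0 < m &
    forall x, pdom A x -> (m * rnorm x ^+ 2)%:C <= dot (A x) x.

(* S is the square root of A: the nonnegative self-adjoint operator with
   S S = A, equality of domains included. *)
Definition is_sqrt_op A S :=
  [/\ selfadjoint S,
      forall x, pdom S x -> 0 <= dot (S x) x,
      forall x, pdom A x <-> pdom S x /\ pdom S (S x)
    & forall x, pdom A x -> A x = S (S x)].

End SelfAdjoint.

(* H_{1/2} and H_{-1/2}; S stands for A^{1/2}. *)
Section Scale.
Context {R : realType} {H : hilbertType R}.
Variable S : linear_op H H.

Definition half_pred : {pred H} := mem (pdom S).

HB.instance Definition _ :=
  GRing.isSubmodClosed.Build _ _ half_pred (pdom_submod S).

Record half_space := MkHalf { half_val :> H; _ : half_val \in half_pred }.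
HB.instance Definition _ := [isSub for half_val].
HB.instance Definition _ := [Choice of half_space by <:].
HB.instance Definition _ := [SubChoice_isSubLmodule of half_space by <:].

Definition half_dot (u v : half_space) : R[i] :=
  dot (S (half_val u)) (S (half_val v)).

Definition half_norm (u : half_space) : R := rnorm (S (half_val u)).

(* The dual of H_{1/2} consists of conjugate-linear functionals, so that H
   embeds into it linearly, by h |-> (z |-> <h, z>). *)
Definition dual_pred : {pred half_space -> R[i]} :=
  mem [set f | (forall a x y, f (a *: x + y) = a^* * f x + f y) /\
               exists C : R, forall z, `|f z| <= (C * half_norm z)%:C].

Lemma dual_submod_closed : submod_closed dual_pred.
Proof.
split.
  apply/mem_set; split => [a x y|]; first by rewrite mulr0 addr0.
  by exists 0 => z; rewrite normr0 mul0r.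
move=> c f g /set_mem[lf [C hC]] /set_mem[lg [D hD]]; apply/mem_set; split.
  move=> a x y.
  suff : c * f (a *: x + y) + g (a *: x + y) =
         a^* * (c * f x + g x) + (c * f y + g y) by [].
  by rewrite lf lg; ring.
exists (complex.Re `|c| * C + D) => z.
rewrite mulrDl rmorphD /= (le_trans (ler_normD _ _))// lerD//.
rewrite normrM -mulrA rmorphM /=.
have -> : (complex.Re `|c|)%:C = `|c|.
  by have := normr_ge0 c; case: `|c| => p q; rewrite lecE /= => /andP[/eqP ->].
by rewrite ler_wpM2l.
Qed.

HB.instance Definition _ :=
  GRing.isSubmodClosed.Build _ _ dual_pred dual_submod_closed.

Record dual_half_space :=
  MkDualHalf { dual_half_fun :> half_space -> R[i];
                _ : dual_half_fun \in dual_pred }.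
HB.instance Definition _ := [isSub for dual_half_fun].
HB.instance Definition _ := [Choice of dual_half_space by <:].
HB.instance Definition _ := [SubChoice_isSubLmodule of dual_half_space by <:].

Definition dual_half_norm (f : dual_half_space) : R :=
  sup [set complex.Re `|f z| | z in [set z | half_norm z <= 1]].

(* f is the image of h under the embedding of H into H_{-1/2}. *)
Definition represents (h : H) (f : dual_half_space) :=
  forall z : half_space, f z = dot h z.

Definition in_pivot (f : dual_half_space) := exists h, represents h f.

Definition pivot_repr (f : dual_half_space) : H :=
  xget 0 [set h | represents h f].

Lemma ext_subproof (u : half_space) : half_dot u \in dual_pred.
Proof.
apply/mem_set; split.
  move=> a x y; rewrite /half_dot /=.
  have mem_half (z : half_space) : pdom S (half_val z).
    by apply: set_mem; case: z.
  by rewrite papp_linear// dotDr dotZr.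
exists (half_norm u) => z.
by rewrite rmorphM /= -!rnormE; exact: cauchy_schwarz.
Qed.

(* The extension of A = S S to a bounded operator from H_{1/2} to H_{-1/2},
   <A u, z> = <S u, S z>. *)
Definition ext_op (u : half_space) : dual_half_space :=
  MkDualHalf (ext_subproof u).

End Scale.

Section Control.
Context {R : realType} {H U : hilbertType R} {S : linear_op H H}.

Definition bounded_to_H (B : U -> H) :=
  exists C : R, forall x, rnorm (B x) <= C * rnorm x.

Definition bounded_to_dual (B : U -> dual_half_space S) :=
  exists C : R, forall x, dual_half_norm (B x) <= C * rnorm x.

Definition is_adjoint (B : U -> dual_half_space S) (Bs : half_space S -> U) :=
  forall x z, B x z = dot x (Bs z).

(* L(U, H) is seen inside L(U, H_{-1/2}) through the pivot embedding. *)
Definition bounded_in_pivot (B : U -> dual_half_space S) :=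
  exists2 B0 : {linear U -> H}, bounded_to_H B0 &
    forall x, represents (B0 x) (B x).

End Control.

Section Wave.
Context {R : realType} {H : hilbertType R}.
Variables A S : linear_op H H.

Definition to_half (v : H) : half_space S := insubd (0 : half_space S) v.

Definition wave_op : partial_op (half_space S * H) (half_space S * H) :=
  PartialOp
    [set X : half_space S * H | pdom A (half_val X.1) /\ pdom S X.2]
    (fun X => (to_half X.2, - A (half_val X.1))).

Definition wave_dot (X Y : half_space S * H) : R[i] :=
  half_dot X.1 Y.1 + dot X.2 Y.2.

Definition wave_norm (X : half_space S * H) : R :=
  Num.sqrt (complex.Re (wave_dot X X)).

Definition orthonormal_basis (e : nat -> half_space S * H) :=
  (forall m n, wave_dot (e m) (e n) = (m == n)%:R) /\
  forall (X : half_space S * H) (eps : R), 0 < eps ->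
    exists N (c : nat -> R[i]),
      wave_norm (X - \sum_(0 <= k < N) c k *: e k) < eps.

End Wave.

Definition is_eigenvector (R : realType) (E : lmodType R[i])
    (A : partial_op E E) (lambda : R[i]) (x : E) :=
  [/\ pdom A x, x <> 0 & A x = lambda *: x].

Section Semigroup.
Context {R : realType} {V : lmodType R[i]}.
Variables (N : V -> R) (Tt : R -> {linear V -> V}).

Definition C0_semigroup :=
  [/\ forall x, Tt 0 x = x,
      forall s t x, 0 <= s -> 0 <= t -> Tt (s + t) x = Tt s (Tt t x),
      forall t, 0 <= t -> exists C : R, forall x, N (Tt t x) <= C * N x
    & forall x, N (Tt t x - x) @[t --> 0^'+] --> (0 : R)].

Definition generated_by (A : partial_op V V) :=
  forall x y, N ((t^-1)%:C *: (Tt t x - x) - y) @[t --> 0^'+] --> (0 : R) <->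
              (pdom A x /\ A x = y).

Definition exponentially_stable :=
  exists C delta : R, [/\ 0 < C, 0 < delta &
    forall t x, 0 <= t -> N (Tt t x) <= C * expR (- (delta * t)) * N x].

Definition strongly_stable :=
  forall x, N (Tt t x) @[t --> +oo] --> (0 : R).

End Semigroup.

Section Augmented.
Context {R : realType} {H U : hilbertType R}.
Variables (S : linear_op H H).
Variables (B : U -> dual_half_space S) (Bs : half_space S -> U).
Variables alpha eta : R.

Let mu : {measure set (measurableTypeR R) -> \bar R} := @lebesgue_measure R.

Definition Gamma (x : R) : R :=
  Rintegral mu `]0, +oo[ (fun t => t `^ (x - 1) * expR (- t)).

Definition gamma : R :=
  2 * sin (alpha * trigo.pi) * Gamma (2^-1 + 1) / trigo.pi `^ (2^-1 + 1).

(* Here 0 `^ a = 0 for a != 0, also when a < 0; the value at xi = 0 plays no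
   role, {0} being negligible. *)
Definition weight (xi : R) : R := `|xi| `^ ((2 * alpha - 1) / 2).

Definition diffusive_space : Type := L2 mu (E := U).

Definition energy_space : Type := (half_space S * H * diffusive_space)%type.

Definition energy_dot (X Y : energy_space) : R[i] :=
  half_dot X.1.1 Y.1.1 + dot X.1.2 Y.1.2 + gamma%:C * L2dot X.2 Y.2.

Definition energy_norm (X : energy_space) : R :=
  Num.sqrt (complex.Re (energy_dot X X)).

Definition energy (X : energy_space) : R := 2^-1 * energy_norm X ^+ 2.

Definition weighted_integral (phi : diffusive_space) : U :=
  bochner_integral mu (fun xi : R => (weight xi)%:C *: repr phi xi).

Definition diffusive_part (v : H) (phi : diffusive_space) (xi : R) : U :=
  - (`|xi| ^+ 2 + eta)%:C *: repr phi xi + (weight xi)%:C *: Bs (to_half S v).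

Definition aug_form (u : half_space S) (phi : diffusive_space) :
    dual_half_space S :=
  ext_op u + gamma%:C *: B (weighted_integral phi).

Definition augmented_op : partial_op energy_space energy_space :=
  PartialOp
    [set X : energy_space | let: (u, v, phi) := X in
      [/\ pdom S v,
          in_pivot (aug_form u phi),
          (fun xi : R => `|xi|%:C *: repr phi xi) \in L2fun mu
        & diffusive_part v phi \in L2fun mu]]
    (fun X => let: (u, v, phi) := X in
      (to_half S v, - pivot_repr (aug_form u phi),
       L2class mu (diffusive_part v phi))).

End Augmented.

Arguments diffusive_space {R} U.
Arguments energy_space {R H} U S.

Definition compact_embedding (R : realType) (H : hilbertType R)
    (S : linear_op H H) :=
  forall r : R, precompact [set x : H | exists2 z : half_space S,
    half_norm z <= r & x = z].

Definition infinite_dimensional (R : realType) (E : lmodType R[i]) :=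
  forall n (e : 'I_n -> E), exists x, forall c : 'I_n -> R[i],
    x <> \sum_i c i *: e i.

Definition wave_mode (R : realType) (H : hilbertType R) (S : linear_op H H)
    (omega : R) (u : half_space S) : half_space S * H :=
  ((0 +i* omega)^-1 *: u, half_val u).

(* Main.v *)
Require Import Defs.
From mathcomp Require Import all_boot all_order all_algebra.
From mathcomp Require Import all_classical all_reals all_analysis.
From mathcomp Require Import measurable_realfun.
From mathcomp Require Import generic_quotient.
From mathcomp Require Import ring lra.
Set Implicit Arguments.
Unset Strict Implicit.
Unset Printing Implicit Defensive.
Import Order.TTheory GRing.Theory Num.Theory.
Import numFieldNormedType.Exports.
Import ComplexField.Normc HBNNSimple.
Local Open Scope classical_set_scope.
Local Open Scope ring_scope.
Local Open Scope complex_scope.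
Local Open Scope quotient_scope.

(** Exponential stability would bound the resolvent of the augmented operator on
    the imaginary axis ([exponentially_stable_resolvent]).  To contradict this,
    each wave mode (u_n / (i omega_n), u_n) is completed by the diffusive
    component phi_n = p B^* u_n / (i omega_n + x^2 + eta), so that only the second
    line of the eigenvalue equation fails, by gamma c_n B B^* u_n where
    |c_n| is at most the integral of p^2 / |i omega_n + x^2 + eta|
    ([aug_mode_defect]).  Since 0 < alpha < 1 this integral is finite and tends to
    0 when |omega_n| tends to infinity ([cvg_decay]); the energy norm of the
    completed mode is at least 1.  Hence the resolvent is unbounded as soon as
    B B^* u_n stays bounded in H along a subsequence
    ([not_exponentially_stable_of_bounded]), and it does when B is bounded into H.

    If B^* u_n = 0, the defect vanishes and the completed mode is a genuine
    eigenvector for i omega_n.  Its energy is conserved, which excludes both kinds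
    of stability.  Conservation is not immediate, because the semigroup is only
    assumed to be bounded at each time, not locally uniformly in time.  The
    eigenspace is invariant and finite-dimensional: an eigenvector is a free
    vibration of the undamped equation ([aug_eigenvector]), hence determined by
    finitely many coordinates in the basis of wave modes.  In finite dimension
    the derivative of the orbits at time 0 is uniform, and the semigroup restricted
    to the eigenspace is isometric ([eigenspace_isometry]).

    The Bochner integral of p phi only enters through its inner products with
    vectors of U, that is, through scalar integrals ([bochner_Re_dot]). *)

(** * Modulus of complex numbers and seminorms *)

Section Modulus.
Context {R : realType}.
Implicit Types a : R[i].

Lemma normc_ge0 a : 0 <= normc a.
Proof. by case: a => x y; exact: sqrtr_ge0. Qed.

Lemma normcN1 : normc (-1 : R[i]) = 1.
Proof. by rewrite /= oppr0 sqrrN expr1n expr0n /= addr0 sqrtr1. Qed.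

Lemma normcR (x : R) : normc x%:C = `|x|.
Proof. by rewrite /= expr0n /= addr0 sqrtr_sqr. Qed.

Lemma normcX a n : normc (a ^+ n) = normc a ^+ n.
Proof. by elim: n => [|n ih]; rewrite ?expr0 ?normc1// !exprS normcM ih. Qed.

End Modulus.

Definition seminorm (R : realType) (V : lmodType R[i]) (N : V -> R) :=
  (forall x y, N (x + y) <= N x + N y) /\
  (forall (a : R[i]) x, N (a *: x) = normc a * N x).

Section Seminorm.
Context {R : realType} {V : lmodType R[i]}.
Variable N : V -> R.
Hypothesis snN : seminorm N.

Lemma snD x y : N (x + y) <= N x + N y. Proof. exact: snN.1. Qed.

Lemma snZ a x : N (a *: x) = normc a * N x. Proof. exact: snN.2. Qed.

Lemma sn0 : N 0 = 0. Proof. by rewrite -[0](scale0r 0) snZ normc0 mul0r. Qed.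

Lemma snN1 x : N (- x) = N x.
Proof. by rewrite -scaleN1r snZ normcN1 mul1r. Qed.

Lemma snB x y : N (x - y) <= N x + N y.
Proof. by rewrite -[N y]snN1 snD. Qed.

Lemma sn_ge0 x : 0 <= N x.
Proof.
have := snB x x; rewrite subrr sn0.
by rewrite -mulr2n pmulrn_lge0.
Qed.

Lemma snZR (a : R) x : 0 <= a -> N (a%:C *: x) = a * N x.
Proof. by move=> a0; rewrite snZ normcR ger0_norm. Qed.

End Seminorm.

(** * Pointwise convergence of seminorms in finite dimension *)

Section UniformSmallness.
Context {R : realType} {V : lmodType R[i]}.

Definition functional (c : V -> R[i]) :=
  forall a x y, c (a *: x + y) = a * c x + c y.

Lemma functionalB c x y a : functional c -> c (x - a *: y) = c x - a * c y.
Proof. by move=> lc; rewrite addrC -scaleNr lc mulNr addrC. Qed.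

(** On a finite-dimensional space, seminorms that tend to 0 at every point do so
    uniformly on bounded sets.  Finite dimension is expressed by finitely many
    functionals that separate the points of [K] up to the seminorms, which
    spares the choice of a basis of [K]: when the last functional is not zero
    on [K], a vector [z] normalised by it splits [K] as its kernel plus the
    line of [z], and the induction applies to the kernel. *)
Lemma seminorm_uniform_cvg0 (q : nat -> V -> R) (c : nat -> V -> R[i]) n
    (K : set V) :
  (forall m, seminorm (q m)) -> (forall k, functional (c k)) ->
  (forall a x y, K x -> K y -> K (a *: x + y)) ->
  (forall x, K x -> (forall k, (k < n)%N -> c k x = 0) ->
     forall m, q m x = 0) ->
  (forall x, K x -> q m x @[m --> \oo] --> (0 : R)) ->
  exists2 e : nat -> R, e m @[m --> \oo] --> (0 : R) &
    forall m x, K x -> q m x <= e m * \sum_(k < n) normc (c k x).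
Proof.
move=> snq lc.
have sum_ge0 n' x : 0 <= \sum_(k < n') normc (c k x).
  by rewrite sumr_ge0// => ? _; exact: normc_ge0.
elim: n K => [|n ih] K linK nullK q0.
  exists (fun=> 0) => [|m x Kx]; first exact: cvg_cst.
  by rewrite mul0r nullK.
have [[y Ky cy0]|nK] := pselect (exists2 y, K y & c n y != 0); last first.
  have [|e e0 he] := ih K linK _ q0.
    move=> x Kx cs0 m; apply: nullK => // k; rewrite ltnS leq_eqVlt.
    move=> /predU1P[->|]; last exact: cs0.
    by apply/eqP; rewrite -[_ == _]negbK; apply/negP => h; apply: nK; exists x.
  exists (fun m => `|e m|); first by rewrite -(normr0 R); exact: cvg_norm.
  move=> m x Kx; apply: (le_trans (he m x Kx)).
  apply: (@le_trans _ _ (`|e m| * \sum_(k < n) normc (c k x))).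
    by rewrite ler_wpM2r ?ler_norm.
  by rewrite ler_wpM2l// big_ord_recr lerDl normc_ge0.
pose z := (c n y)^-1 *: y.
have K0 : K 0 by have := linK (-1) y y Ky Ky; rewrite scaleN1r addNr.
have Kz : K z by have := linK (c n y)^-1 y 0 Ky K0; rewrite addr0.
have c0 : c n 0 = 0.
  by have := lc n (-1) y y; rewrite scaleN1r addNr mulN1r addNr.
have cz : c n z = 1 by rewrite -[z]addr0 lc c0 addr0 mulVf.
pose K' := K `&` [set x | c n x = 0].
have [| |x [Kx _]|e e0 he] := ih K'; last 1 first.
- pose M := 1 + \sum_(k < n) normc (c k z).
  exists (fun m => `|e m| * M + q m z).
    rewrite -(addr0 0); apply: cvgD; last exact: q0.
    by rewrite -(mul0r M); apply: cvgMr_tmp; rewrite -(normr0 R); exact: cvg_norm.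
  move=> m x Kx.
  have K'x : K' (x - c n x *: z).
    split => /=; last by rewrite functionalB// cz mulr1 subrr.
    by rewrite addrC -scaleNr; exact: linK.
  have h1 : q m x <= q m (x - c n x *: z) + normc (c n x) * q m z.
    by rewrite -(snZ (snq m)); have := snD (snq m) (x - c n x *: z) (c n x *: z);
      rewrite subrK.
  apply: (le_trans h1); rewrite big_ord_recr/= mulrDl lerD//; last first.
    by rewrite mulrC ler_wpM2l ?(sn_ge0 (snq m))// lerDr sum_ge0.
  apply: (le_trans (he m _ K'x)).
  apply: (@le_trans _ _ (`|e m| * \sum_(k < n) normc (c k (x - c n x *: z)))).
    by rewrite ler_wpM2r ?ler_norm.
  rewrite -mulrA ler_wpM2l//.
  have : \sum_(k < n) normc (c k (x - c n x *: z)) <=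
     \sum_(k < n) (normc (c k x) + normc (c n x) * normc (c k z)).
    apply: ler_sum => k _; rewrite functionalB//.
    by rewrite -normcM -[normc (c n x * _)]normcN le_normcD.
  move/le_trans; apply; rewrite big_split/= -mulr_sumr /M.
  have := sum_ge0 n x; have := sum_ge0 n z; have := normc_ge0 (c n x).
  move: (\sum_(_ < _) _) (\sum_(_ < _) _) (normc (c n x)) => s1 s2 d d0 s20 s10.
  have : 0 <= s1 * s2 by rewrite mulr_ge0.
  nra.
- move=> a x x' [Kx cx] [Kx' cx']; split; first exact: linK.
  by rewrite /= lc cx cx' mulr0 addr0.
- move=> x [Kx cx] cs0 m; apply: nullK => // k; rewrite ltnS leq_eqVlt.
  by move=> /predU1P[->//|]; exact: cs0.
- exact: q0.
Qed.

End UniformSmallness.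

(** * Semigroups near an eigenvalue on the imaginary axis *)

(** A two-sided discrete Gronwall inequality. *)
Lemma slow_variation (R : realType) (v : nat -> R) (e : R) :
  0 <= e -> (forall k, 0 <= v k) ->
  (forall k, `|v k.+1 - v k| <= e * v k) ->
  forall k, `|v k - v 0%N| <= k%:R * e * expR (k%:R * e) * v 0%N.
Proof.
move=> e0 v0 ve.
have vk k : v k <= expR (k%:R * e) * v 0%N.
  elim: k => [|k ih]; first by rewrite mul0r expR0 mul1r.
  rewrite -natr1 mulrDl mul1r expRD.
  have := ve k; rewrite ler_norml => /andP[_ h].
  have := expR_ge1Dx e; have := v0 k; have := v0 0%N.
  set E := expR e; set F := expR _ in ih *.
  move=> p0 pk Ee; apply: (@le_trans _ _ ((1 + e) * v k)); first lra.
  rewrite [F * E]mulrC -mulrA; apply: ler_pM => //; lra.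
elim => [|k ih]; first by rewrite subrr normr0 !mul0r.
have -> : v k.+1 - v 0%N = (v k.+1 - v k) + (v k - v 0%N).
  by rewrite addrA subrK.
apply: (le_trans (ler_normD _ _)).
have mono : expR (k%:R * e) <= expR (k.+1%:R * e).
  by rewrite ler_expR ler_wpM2r// ler_nat.
have h1 : e * v k <= e * (expR (k.+1%:R * e) * v 0%N).
  by rewrite ler_wpM2l// (le_trans (vk k))// ler_wpM2r.
have h2 : k%:R * e * expR (k%:R * e) * v 0%N <=
          k%:R * e * expR (k.+1%:R * e) * v 0%N.
  by rewrite ler_wpM2r// ler_wpM2l// mulr_ge0.
apply: (le_trans (lerD (le_trans (ve k) h1) (le_trans ih h2))).
set F := expR (k.+1%:R * e).
by rewrite -[in leRHS]natr1 le_eqVlt; apply/orP; left; apply/eqP; ring.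
Qed.

Section Semigroup.
Context {R : realType} {V : lmodType R[i]}.
Variables (N : V -> R) (Tt : R -> {linear V -> V}) (A : partial_op V V).
Hypothesis snN : seminorm N.
Hypothesis sgT : C0_semigroup N Tt.
Hypothesis genT : generated_by N Tt A.

(** The factor of one step of length [h] of the explicit Euler scheme for
    x' = i w x.  Its modulus is at least 1 and at most 1 + O(h^2), so that t/h
    steps neither decrease the norm nor increase it in the limit. *)
Definition euler_factor (w h : R) : R[i] := 1 +i* (w * h).

Lemma euler_factor_ge1 w h : 1 <= normc (euler_factor w h).
Proof.
rewrite /= -[leLHS]sqrtr1 ler_wsqrtr// expr1n lerDl sqr_ge0//.
Qed.

Lemma euler_factor_le w h : normc (euler_factor w h) <= 1 + (w * h) ^+ 2.
Proof.
have h0 : 0 <= (w * h) ^+ 2 by exact: sqr_ge0.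
have h1 : 0 <= 1 + (w * h) ^+ 2 by rewrite addr_ge0.
rewrite /= -[leRHS](ger0_norm h1) -[leRHS]sqrtr_sqr ler_wsqrtr// expr1n; nra.
Qed.

Lemma semigroup_nat n (h : R) x : 0 <= h ->
  Tt (n.+1%:R * h) x = Tt (n%:R * h) (Tt h x).
Proof.
case: sgT => _ sg _ _ h0.
by rewrite -sg ?mulr_ge0// -natr1 mulrDl mul1r.
Qed.

(** T(nh) - a^n is a telescoping sum of terms T(kh) (T(h) - a) a^(n-1-k).
    Working with powers of the Euler factor instead of exp(i w t) makes the
    generator at a single vector enough: no derivative or integral of the orbit
    is involved. *)
Lemma euler_telescope (a : R[i]) (h C : R) n x : 1 <= normc a -> 0 <= h ->
  (forall k y, N (Tt (k%:R * h) y) <= C * N y) ->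
  N (Tt (n%:R * h) x - a ^+ n *: x) <=
    n%:R * C * normc a ^+ n * N (Tt h x - a *: x).
Proof.
case: sgT => T0 sg _ _ a1 h0 TC.
have CN y : 0 <= C * N y.
  by apply: le_trans (TC 0%N y); exact: (sn_ge0 snN).
elim: n => [|n ih].
  by rewrite !mul0r T0 expr0 scale1r subrr (sn0 snN).
have -> : Tt (n.+1%:R * h) x - a ^+ n.+1 *: x =
    Tt (n%:R * h) (Tt h x - a *: x) + a *: (Tt (n%:R * h) x - a ^+ n *: x).
  rewrite semigroup_nat// [X in _ = X + _](linearB (Tt (n%:R * h))).
  by rewrite [Tt (n%:R * h) (a *: x)]linearZ/= scalerBr scalerA -exprS addrA subrK.
apply: (le_trans (snD snN _ _)); rewrite (snZ snN).
have := TC n (Tt h x - a *: x).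
set d := N (Tt h x - a *: x) => h1.
have an : 1 <= normc a ^+ n by rewrite exprn_ege1.
have an1 : 1 <= normc a ^+ n.+1 by rewrite exprn_ege1.
have : normc a * N (Tt (n%:R * h) x - a ^+ n *: x) <=
    n%:R * C * normc a ^+ n.+1 * d.
  rewrite exprS.
  rewrite [leRHS](_ : _ = normc a * (n%:R * C * normc a ^+ n * d)); last by ring.
  by rewrite ler_wpM2l// (le_trans _ a1).
rewrite -natr1; have := CN (Tt h x - a *: x); rewrite -/d; nra.
Qed.

Lemma cvg_at_right_div (d : R -> R) (l t : R) : 0 < t ->
  d h @[h --> 0^'+] --> l -> d (t / n.+1%:R) @[n --> \oo] --> l.
Proof.
move=> t0 /cvg_at_rightP; apply; split => [n|]; first by rewrite divr_gt0.
rewrite -(mulr0 t); apply: cvgMl_tmp; exact: cvg_harmonic.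
Qed.

Lemma euler_defect (w : R) x : pdom A x ->
  exists2 d : R -> R, d h @[h --> 0^'+] --> (0 : R) &
  forall h, 0 < h -> N (Tt h x - euler_factor w h *: x) <=
    h * (d h + N ((0 +i* w) *: x - A x)).
Proof.
move=> Dx; exists (fun h => N ((h^-1)%:C *: (Tt h x - x) - A x)).
  exact: (genT x (A x)).2.
move=> h h0; rewrite -(snN1 snN ((0 +i* w) *: x - A x)).
apply: le_trans (ler_wpM2l (ltW h0) (snD snN _ _)).
rewrite -(snZR snN)// ?(ltW h0)//.
rewrite le_eqVlt; apply/orP; left; apply/eqP; congr N.
rewrite opprB addrA subrK scalerBr scalerA -rmorphM/= mulfV ?gt_eqF// scale1r.
rewrite scalerA (_ : euler_factor w h = 1 + h%:C * (0 +i* w)).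
  by rewrite scalerDl scale1r opprD addrA.
by apply/eqP; rewrite eq_complex /= !mul0r mulr0 subrr !addr0 add0r mulrC !eqxx.
Qed.



(** The discrete form of Duhamel's formula
    x = exp(-i w t) T(t) x + int_0^t exp(-i w s) T(s) (i w - A) x ds,
    obtained by letting the step of the Euler scheme tend to 0. *)
Lemma euler_steps (w t C : R) x : pdom A x -> 0 < t -> 0 <= C ->
  (forall s y, 0 <= s -> N (Tt s y) <= C * N y) ->
  N x <= N (Tt t x) + C * t * N ((0 +i* w) *: x - A x).
Proof.
move=> Dx t0 C0 TC; have [d d0 hd] := euler_defect w Dx.
set Y := N _ in hd *.
have step n : N x <= N (Tt t x) + C * t * (d (t / n.+1%:R) + Y).
  set h := t / n.+1%:R; have h0 : 0 < h by rewrite divr_gt0.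
  pose a := euler_factor w h.
  have a1 : 1 <= normc a := euler_factor_ge1 w h.
  have nh : n.+1%:R * h = t by rewrite mulrC divfK.
  have h1 : N (Tt t x - a ^+ n.+1 *: x) <=
      n.+1%:R * C * normc a ^+ n.+1 * N (Tt h x - a *: x).
    rewrite -nh; apply: euler_telescope (ltW h0) _ => // k y.
    by apply: TC; rewrite mulr_ge0// ltW.
  have := hd h h0; rewrite -/a => h2.
  have an : 1 <= normc a ^+ n.+1 by rewrite exprn_ege1.
  have an0 : 0 < normc a ^+ n.+1 by rewrite (lt_le_trans _ an).
  have h3 : normc a ^+ n.+1 * N x <= N (Tt t x) +
      C * t * normc a ^+ n.+1 * (d h + Y).
    rewrite -normcX -(snZ snN).
    have := snB snN (Tt t x) (Tt t x - a ^+ n.+1 *: x).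
    rewrite opprB addrC subrK => /le_trans; apply; rewrite lerD2l.
    apply: (le_trans h1); rewrite normcX.
    rewrite [leRHS](_ : _ = n.+1%:R * C * normc a ^+ n.+1 * (h * (d h + Y))).
      by rewrite ler_wpM2l// !mulr_ge0// ltW.
    by rewrite -nh; ring.
  rewrite -(ler_pM2l an0); apply: (le_trans h3).
  rewrite [leRHS]mulrDr lerD//; first by rewrite ler_peMl// (sn_ge0 snN).
  by rewrite le_eqVlt; apply/orP; left; apply/eqP; ring.
have lim : N (Tt t x) + C * t * (d (t / n.+1%:R) + Y) @[n --> \oo] -->
    N (Tt t x) + C * t * (0 + Y).
  apply: cvgD; first exact: cvg_cst.
  apply: cvgMl_tmp; apply: cvgD; last exact: cvg_cst.
  exact: cvg_at_right_div.
rewrite -[Y]add0r; apply: ler_cvg_to (cvg_cst _) lim _ => //; exact: nearW.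
Qed.

(** Exponential stability bounds the resolvent on the imaginary axis: after a
    time [t] at which the norm of T(t) is at most 1/2, the first term of
    [euler_steps] is absorbed by the left-hand side. *)
Lemma exponentially_stable_resolvent : exponentially_stable N Tt ->
  exists2 M : R, 0 <= M &
    forall w x, pdom A x -> N x <= M * N ((0 +i* w) *: x - A x).
Proof.
move=> [C [delta [C0 delta0 TC]]].
have TC' s y : 0 <= s -> N (Tt s y) <= C * N y.
  move=> s0; apply: (le_trans (TC s y s0)); rewrite ler_wpM2r ?(sn_ge0 snN)//.
  by rewrite ler_piMr ?(ltW C0)// expR_le1 oppr_le0 mulr_ge0// ltW.
(* With E = 2 C + 1, C exp(-E) <= C / (1 + E) <= 1/2. *)
pose t := (2 * C + 1) / delta.
have t0 : 0 < t by rewrite divr_gt0// addr_gt0// mulr_gt0.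
exists (2 * (C * t)) => [|w x Dx].
  by rewrite mulr_ge0 ?(mulr_ge0 (ltW C0) (ltW t0)).
have := euler_steps w Dx t0 (ltW C0) TC'.
have := TC t x (ltW t0).
have -> : delta * t = 2 * C + 1 by rewrite mulrC divfK// gt_eqF.
have eC : C * expR (- (2 * C + 1)) <= 2^-1.
  rewrite expRN ler_pdivrMr ?expR_gt0//.
  by have := expR_ge1Dx (2 * C + 1); set E := expR _; lra.
have := sn_ge0 snN x; set Y := N _; nra.
Qed.


Definition op_eigenspace (w : R) : set V :=
  [set x | pdom A x /\ A x = (0 +i* w) *: x].

Lemma eigenspace_lin w a x y :
  op_eigenspace w x -> op_eigenspace w y -> op_eigenspace w (a *: x + y).
Proof.
move=> /(genT _ _).2 hx /(genT _ _).2 hy; apply/(genT _ _).1.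
have lim : normc a * N ((t^-1)%:C *: (Tt t x - x) - (0 +i* w) *: x) +
    N ((t^-1)%:C *: (Tt t y - y) - (0 +i* w) *: y) @[t --> 0^'+] --> (0 : R).
  rewrite -[X in _ --> X](addr0 0); apply: cvgD; last exact: hy.
  by rewrite -[X in _ --> X](mulr0 (normc a)); apply: cvgMl_tmp hx.
apply: (squeeze_cvgr _ (cvg_cst 0) lim).
apply: nearW => t; rewrite (sn_ge0 snN)/= -(snZ snN).
apply: le_trans (snD snN _ _); rewrite le_eqVlt; apply/orP; left; apply/eqP.
congr N; rewrite linearP; set X := Tt t x; set Y := Tt t y.
have -> : a *: X + Y - (a *: x + y) = a *: (X - x) + (Y - y).
  by rewrite opprD addrACA scalerBr.
move: (X - x) (Y - y) (t^-1)%:C => P Q b; set l := 0 +i* w.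
rewrite [b *: _]scalerDr [l *: _]scalerDr opprD addrACA; congr (_ + _).
by rewrite scalerBr !scalerA [b * a]mulrC [l * a]mulrC.
Qed.

Lemma eigenspace_invariant w s x :
  0 <= s -> op_eigenspace w x -> op_eigenspace w (Tt s x).
Proof.
case: sgT => _ sg bnd _ s0 /(genT _ _).2 hx; apply/(genT _ _).1.
have [C TC] := bnd s s0.
have lim : C * N ((t^-1)%:C *: (Tt t x - x) - (0 +i* w) *: x)
    @[t --> 0^'+] --> (0 : R).
  by rewrite -[X in _ --> X](mulr0 C); apply: cvgMl_tmp.
apply: (squeeze_cvgr _ (cvg_cst 0) lim).
near=> t; rewrite (sn_ge0 snN)/=.
have t0 : 0 <= t by near: t; exact: nbhs_right_ge.
apply: le_trans (TC _); rewrite le_eqVlt; apply/orP; left; apply/eqP.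
rewrite -sg// [t + s]addrC.
congr N; rewrite [X in _ = X]raddfB/= [X in _ = X - _]linearZ/=.
by rewrite [X in _ = _ - X]linearZ/= [X in _ = _ *: X - _]raddfB/= sg.
Unshelve. all: by end_near. Qed.

(** On a finite-dimensional eigenspace of the generator for the eigenvalue i w,
    every T(t) is isometric.  An orbit in the eigenspace has right derivative
    i w times itself, but C_0 semigroups are only known here to be bounded at
    each fixed time, so the orbit of a single vector could be discontinuous from
    the left.  Finite dimension repairs this: the error of one Euler step is
    o(h) uniformly on the eigenspace, which is invariant, so the norm varies
    over t/h steps by a factor 1 + o(1). *)
Lemma eigenspace_isometry w t (c : nat -> V -> R[i]) (L : nat -> R) n :
  (forall k, functional (c k)) ->
  (forall k x, normc (c k x) <= L k * N x) ->
  (forall x, op_eigenspace w x ->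
     (forall k, (k < n)%N -> c k x = 0) -> N x = 0) ->
  0 <= t -> forall x, op_eigenspace w x -> N (Tt t x) = N x.
Proof.
move=> lc bc nul; case: (sgT) => T0 sg bnd _.
rewrite le_eqVlt => /predU1P[<- x _|t0]; first by rewrite T0.
pose h m : R := t / m.+1%:R.
have h0 m : 0 < h m by rewrite divr_gt0.
pose D m x := Tt (h m) x - euler_factor w (h m) *: x.
(* The total error over m + 1 steps of length h m. *)
pose q m x := m.+1%:R * N (D m x).
have snq m : seminorm (q m).
  split=> [x y|a x]; rewrite /q /D.
    rewrite -mulrDr ler_wpM2l// linearD scalerDr opprD addrACA.
    exact: (snD snN).
  rewrite [Tt _ (a *: x)]linearZ/= scalerA [_ * a]mulrC -scalerA -scalerBr.
  by rewrite (snZ snN) mulrCA.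
have DN0 m x : N x = 0 -> N (D m x) = 0.
  move=> x0; apply/eqP; rewrite eq_le (sn_ge0 snN) andbT.
  apply: (le_trans (snB snN _ _)); rewrite (snZ snN) x0 mulr0 addr0.
  by have [C /(_ x)] := bnd (h m) (ltW (h0 m)); rewrite x0 mulr0.
have [|x Kx cs0 m|x [Dx Ax]|e e0 he] :=
    seminorm_uniform_cvg0 (n := n) (K := op_eigenspace w) snq lc.
- exact: eigenspace_lin.
- by rewrite /q DN0 ?mulr0//; exact: nul.
- have [d d0 hd] := euler_defect w Dx.
  have lim : t * d (h m) @[m --> \oo] --> (0 : R).
    rewrite -[X in _ --> X](mulr0 t); apply: cvgMl_tmp.
    exact: cvg_at_right_div.
  apply: (squeeze_cvgr _ (cvg_cst 0) lim); apply: nearW => m.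
  rewrite (sn_ge0 (snq m))/= /q.
  have := hd _ (h0 m); rewrite Ax subrr (sn0 snN) addr0 => hd'.
  apply: (@le_trans _ _ (m.+1%:R * (h m * d (h m)))); first by rewrite ler_wpM2l.
  by rewrite mulrA [_ * h m]mulrC divfK.
pose M : R := \sum_(k < n) `|L k|.
have M0 : 0 <= M by rewrite sumr_ge0.
have sumM x : \sum_(k < n) normc (c k x) <= M * N x.
  rewrite mulr_suml; apply: ler_sum => k _; apply: (le_trans (bc k x)).
  by rewrite ler_wpM2r ?(sn_ge0 snN)// ler_norm.
(* The relative variation of the norm over m + 1 steps: the first term is the
   uniform error, the second one comes from the modulus of the Euler factor. *)
pose dl m := `|e m| * M + (w * t) ^+ 2 / m.+1%:R.
have dl0 m : 0 <= dl m.
  by apply: addr_ge0; [exact: mulr_ge0|rewrite divr_ge0// sqr_ge0].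
have dlim : dl m @[m --> \oo] --> (0 : R).
  rewrite -[X in _ --> X](addr0 0); apply: cvgD.
    rewrite -[X in _ --> X](mul0r M); apply: cvgMr_tmp; rewrite -(normr0 R).
    exact: cvg_norm.
  rewrite -[X in _ --> X](mulr0 ((w * t) ^+ 2)); apply: cvgMl_tmp.
  exact: cvg_harmonic.
have stepK m x : op_eigenspace w x ->
    `|N (Tt (h m) x) - N x| <= dl m / m.+1%:R * N x.
  move=> Kx; set a := euler_factor w (h m).
  have a1 : 1 <= normc a := euler_factor_ge1 w (h m).
  have a2 : normc a <= 1 + (w * h m) ^+ 2 := euler_factor_le w (h m).
  have N0 := sn_ge0 snN x.
  have hD : N (D m x) <= `|e m| * M / m.+1%:R * N x.
    rewrite mulrAC ler_pdivlMr// mulrC; apply: (le_trans (he m x Kx)).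
    rewrite -mulrA; apply: le_trans (ler_wpM2l (normr_ge0 _) (sumM x)).
    by rewrite ler_wpM2r ?ler_norm// sumr_ge0// => ? _; exact: normc_ge0.
  have h1 : N (Tt (h m) x) <= N (D m x) + normc a * N x.
    by have := snD snN (D m x) (a *: x); rewrite subrK (snZ snN).
  have h2 : normc a * N x <= N (Tt (h m) x) + N (D m x).
    have := snB snN (Tt (h m) x) (D m x).
    by rewrite /D opprB addrC subrK (snZ snN).
  have hh : (w * h m) ^+ 2 <= (w * t) ^+ 2 / m.+1%:R / m.+1%:R.
    by rewrite /h mulrA expr_div_n -[leRHS]mulrA -invfM -expr2.
  rewrite /dl mulrDl mulrDl; set p := _ / _ * N x in hD *.
  have hh' : (w * h m) ^+ 2 * N x <= (w * t) ^+ 2 / m.+1%:R / m.+1%:R * N x.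
    by rewrite ler_wpM2r.
  have a1' : N x <= normc a * N x by rewrite ler_peMl.
  have a2' : normc a * N x <= N x + (w * h m) ^+ 2 * N x.
    by rewrite -[X in X + _]mul1r -mulrDl ler_wpM2r.
  have z0 : 0 <= (w * h m) ^+ 2 * N x by rewrite mulr_ge0 ?sqr_ge0.
  move: hD hh' z0 a1' a2' h1 h2; clear.
  move: p ((w * h m) ^+ 2 * N x) ((w * t) ^+ 2 / m.+1%:R / m.+1%:R * N x) => p y z.
  move: (normc a * N x) (N (D m x)) (N (Tt (h m) x)) (N x) => b d v u.
  by move=> ? ? ? ? ? ? ?; rewrite ler_norml; apply/andP; split; lra.
move=> x Kx.
have main m : `|N (Tt t x) - N x| <= dl m * expR (dl m) * N x.
  have nh : m.+1%:R * h m = t by rewrite mulrC divfK.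
  have ne : m.+1%:R * (dl m / m.+1%:R) = dl m by rewrite mulrC divfK.
  have := @slow_variation _ (fun k => N (Tt (k%:R * h m) x)) (dl m / m.+1%:R).
  move=> /(_ _ _ _ m.+1); rewrite nh ne mul0r T0; apply.
  - by rewrite divr_ge0.
  - by move=> k; exact: (sn_ge0 snN).
  move=> k; have hn0 := ltW (h0 m).
  have kh0 : 0 <= k%:R * h m by exact: mulr_ge0.
  rewrite -[k.+1%:R]natr1 mulrDl mul1r [_ + h m]addrC sg//.
  by apply: stepK; exact: eigenspace_invariant.
have lim : dl m * expR (dl m) * N x @[m --> \oo] --> (0 : R).
  rewrite -[X in _ --> X](mul0r (N x)); apply: cvgMr_tmp.
  rewrite -[X in _ --> X](mul0r (expR 0)); apply: cvgM => //.
  by apply: continuous_cvg => //; exact: continuous_expR.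
have : `|N (Tt t x) - N x| <= 0.
  by apply: (ler_cvg_to (cvg_cst _) lim); apply: nearW => m; exact: main.
by rewrite normr_le0 subr_eq0 => /eqP.
Qed.

End Semigroup.

(** * Inner products *)

Section Dot.
Context {R : realType} {E : hilbertType R}.
Implicit Types x y z : E.

Lemma rnormZc (a : R[i]) x : rnorm (a *: x) = normc a * rnorm x.
Proof. by rewrite rnormZ. Qed.

Lemma rnorm0 : rnorm (0 : E) = 0.
Proof. by rewrite /rnorm normr0. Qed.

Lemma rnorm_eq0 x : rnorm x = 0 -> x = 0.
Proof. by move=> x0; apply/normr0_eq0; rewrite rnormE x0. Qed.

Lemma dotNl x y : dot (- x) y = - dot x y.
Proof. by rewrite -scaleN1r dotZl mulN1r. Qed.

Lemma dotNr x y : dot x (- y) = - dot x y.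
Proof. by rewrite dotC dotNl rmorphN/= -dotC. Qed.

Lemma Re_dotxx x : complex.Re (dot x x) = rnorm x ^+ 2.
Proof. by rewrite dot_norm rnormE -rmorphXn. Qed.

Lemma dotxxE x : dot x x = (rnorm x ^+ 2)%:C.
Proof. by rewrite dot_norm rnormE -rmorphXn. Qed.

Lemma normc_dot_le x y : normc (dot x y) <= rnorm x * rnorm y.
Proof.
have := cauchy_schwarz x y.
by rewrite -[`|dot x y|]/((normc (dot x y))%:C) !rnormE -rmorphM/= lecR.
Qed.

Lemma Re_le_normc (a : R[i]) : `|complex.Re a| <= normc a.
Proof.
by case: a => a b /=; rewrite -sqrtr_sqr ler_wsqrtr// lerDl sqr_ge0.
Qed.

Lemma Re_dot_le x y : `|complex.Re (dot x y)| <= rnorm x * rnorm y.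
Proof. exact: le_trans (Re_le_normc _) (normc_dot_le _ _). Qed.

Lemma dot_ext x y : (forall z, dot x z = dot y z) -> x = y.
Proof.
move=> h; apply/eqP; rewrite -subr_eq0; apply/eqP/rnorm_eq0/eqP.
by rewrite -sqrf_eq0 -Re_dotxx dotDl dotNl h subrr.
Qed.

(** The triangle inequality in the squared form that survives integration
    without the Minkowski inequality; see [seminorm_sqrt] for the way back. *)
Lemma ler_rnormD_weighted (s : R) x y : 0 < s ->
  rnorm (x + y) ^+ 2 <= (1 + s) * rnorm x ^+ 2 + (1 + s^-1) * rnorm y ^+ 2.
Proof.
move=> s0; apply: (@le_trans _ _ ((rnorm x + rnorm y) ^+ 2)).
  by rewrite ler_pXn2r ?nnegrE ?addr_ge0 ?rnorm_ge0// ler_rnormD.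
rewrite -subr_ge0 (_ : _ - _ = s^-1 * (s * rnorm x - rnorm y) ^+ 2).
  by rewrite mulr_ge0 ?sqr_ge0// invr_ge0 ltW.
by field; rewrite gt_eqF.
Qed.

End Dot.

(** * Strong measurability and the Bochner integral *)

Section StrongMeasurability.
Context d (T : measurableType d) (R : realType).
Variable mu : {measure set T -> \bar R}.
Context {E : hilbertType R}.
Implicit Types f : T -> E.

Lemma strongly_measurable_scaleR (g : T -> R) f :
  measurable_fun [set: T] g -> (forall x, 0 <= g x) ->
  strongly_measurable mu f ->
  strongly_measurable mu (fun x => (g x)%:C *: f x).
Proof.
move=> mg g0 [s [hs sf]].
have mG : measurable_fun [set: T] (EFin \o g) by exact/measurable_EFinP.
pose h := nnsfun_approx measurableT mG.
pose ys n := finmap.enum_fset (fset_set (range (h n))).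
exists (fun n => [seq (h n @^-1` [set y] `&` p.1, y%:C *: p.2)
  | y <- ys n, p <- s n]); split.
  move=> n p /allpairsP[[y q] /= [_ qs ->]] /=; have [mq fq] := hs n q qs.
  split; first by apply: measurableI => //; exact: measurable_sfunP.
  apply: le_lt_trans fq; apply: le_measure; rewrite ?inE//.
  by apply: measurableI => //; exact: measurable_sfunP.
move=> x.
rewrite [X in X @ _ --> _](_ : _ =
    (fun n => (h n x)%:C *: simple_fun (s n) x)).
  apply: cvgZ; last exact: sf.
  have /fine_cvgP[_ hg] := cvg_nnsfun_approx measurableT mG
    (fun t _ => g0 t : (0 <= (EFin \o g) t)%E) (I : [set: T] x).
  apply/cvgrPdist_lt => e; rewrite ltcE => /andP[/eqP ie e0].
  move/cvgrPdist_lt : hg => /(_ _ e0); apply: filterS => n.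
  rewrite -rmorphB /= ltcE /= ie eqxx /=.
  by rewrite expr0n /= addr0 sqrtr_sqr.
apply/funext => n; rewrite /simple_fun big_allpairs_dep.
rewrite [in RHS](fimfunE (h n) x) fsbig_finite//= rmorph_sum scaler_suml.
apply: eq_bigr => y _; rewrite scaler_sumr; apply: eq_bigr => p _ /=.
rewrite indicI /= !scalerA -!rmorphM/=; congr (_%:C *: _); ring.
Qed.

Lemma near_rnormB (u : nat -> E) (w : E) (e : R) : u n @[n --> \oo] --> w ->
  0 < e -> \forall n \near \oo, rnorm (w - u n) < e.
Proof.
move=> /cvgrPdist_lt uw e0; have ec0 : (0 : R[i]) < e%:C by rewrite ltcR.
by have := uw _ ec0; apply: filterS => n; rewrite rnormE ltcR.
Qed.

Lemma strongly_measurable_simple (l : seq (set T * E)) :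
  simple_data mu l -> strongly_measurable mu (simple_fun l : T -> E).
Proof. by move=> hl; exists (fun=> l); split => // x; exact: cvg_cst. Qed.

Lemma measurable_Re_dot f (z : E) : strongly_measurable mu f ->
  measurable_fun [set: T] (fun x => complex.Re (dot (f x) z)).
Proof.
move=> [s [hs sf]].
apply: (@measurable_fun_cvg _ _ _ _
  (fun n x => complex.Re (dot (simple_fun (s n) x) z))); last first.
  move=> x _; apply/cvgrPdist_le => e e0.
  have e1 : 0 < e / (rnorm z + 1) by rewrite divr_gt0// ltr_wpDl// rnorm_ge0.
  have := near_rnormB (sf x) e1; apply: filterS => n hn.
  rewrite -raddfB -dotNl -dotDl; apply: (le_trans (Re_dot_le _ _)).
  rewrite ltr_pdivlMr ?ltr_wpDl ?rnorm_ge0// in hn.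
  apply: le_trans (ltW hn); rewrite ler_wpM2l ?rnorm_ge0//; lra.
move=> n; elim: (s n) (hs n) => [|[A v] l ih] hl.
  rewrite (_ : (fun _ => _) = cst 0); first exact: measurable_cst.
  by apply/funext => x; rewrite /simple_fun big_nil dot0l.
have [mA _] : measurable A /\ (mu A < +oo)%E.
  by apply: (hl (A, v)); rewrite inE eqxx.
rewrite (_ : (fun _ => _) = (fun x => \1_A x * complex.Re (dot v z)
    + complex.Re (dot (simple_fun l x) z))).
  apply: measurable_funD.
    by apply: measurable_funM => //; exact: measurable_indic.
  by apply: ih => p pl; apply: hl; rewrite inE pl orbT.
apply/funext => x; rewrite /simple_fun big_cons /= dotDl dotZl raddfD/=.
by case: (dot v z) => a b /=; rewrite mul0r subr0.
Qed.

Lemma Re_dot_simple (l : seq (set T * E)) (z : E) : simple_data mu l ->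
  mu.-integrable [set: T] (fun x => (complex.Re (dot (simple_fun l x) z))%:E) /\
  complex.Re (dot (simple_integral mu l) z) =
  Rintegral mu [set: T] (fun x => complex.Re (dot (simple_fun l x) z)).
Proof.
elim: l => [|[A v] l ih] hl.
  rewrite (_ : (fun _ => _) = cst 0%E); last first.
    by apply/funext => x; rewrite /simple_fun big_nil dot0l.
  split; first exact: integrable0.
  rewrite /simple_integral big_nil dot0l /Rintegral.
  under eq_integral do rewrite /simple_fun big_nil dot0l.
  by rewrite integral0.
have [mA fA] : measurable A /\ (mu A < +oo)%E.
  by apply: (hl (A, v)); rewrite inE eqxx.
have {ih}[i1 i2] : _ := ih (fun p pl => hl p (@predU1r _ _ _ _ pl)).
pose c := complex.Re (dot v z).
have e x : complex.Re (dot (simple_fun ((A, v) :: l) x) z) =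
    c * \1_A x + complex.Re (dot (simple_fun l x) z).
  rewrite /simple_fun big_cons /= dotDl dotZl raddfD/= /c.
  by case: (dot v z) => a b /=; rewrite mul0r subr0 mulrC.
have iA : mu.-integrable [set: T] (EFin \o (\1_A : T -> R)).
  apply/integrableP; split; first exact/measurable_EFinP.
  under eq_integral do rewrite /= ger0_norm//.
  by rewrite integral_indic// setIT.
have icA : mu.-integrable [set: T] (EFin \o (fun x => c * \1_A x)).
  by apply: (eq_integrable _ (fun x => c%:E * (\1_A x)%:E)%E) => //;
    exact: integrableZl.
split.
  apply: (eq_integrable _ (fun x => (c * \1_A x)%:E +
    (complex.Re (dot (simple_fun l x) z))%:E)%E) => //.
    by move=> x _; rewrite e.
  exact: integrableD.
under eq_Rintegral do rewrite e.
rewrite RintegralD// RintegralZl// -i2 /simple_integral big_cons /= dotDl dotZl.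
rewrite raddfD/=; congr (_ + _).
rewrite /Rintegral integral_indic// setIT /c.
by case: (dot v z) => a b /=; rewrite mul0r subr0 mulrC.
Qed.

(** The Bochner integral commutes with the real functionals Re <., z>.  These
    determine a vector, so the value of an integral can be identified through
    scalar integrals. *)
Lemma bochner_Re_dot f (w z : E) : is_bochner mu f w ->
  mu.-integrable [set: T] (fun x => (complex.Re (dot (f x) z))%:E) /\
  complex.Re (dot w z) =
    Rintegral mu [set: T] (fun x => complex.Re (dot (f x) z)).
Proof.
move=> [mf [s [hs int0 sw]]].
have mfz := measurable_Re_dot z mf.
pose r n x := rnorm (f x - simple_fun (s n) x).
have mr n : measurable_fun [set: T] (r n).
  apply: (@measurable_rnorm _ _ _ mu).
  rewrite (_ : (fun _ => _) = (-1 : R[i]) *: simple_fun (s n) + f).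
    by apply: strongly_measurable_lin => //; exact: strongly_measurable_simple.
  by apply/funext => x; rewrite !fctE scaleN1r addrC.
have r0 n x : 0 <= r n x by exact: rnorm_ge0.
have diff_le n x : `|complex.Re (dot (f x) z) -
    complex.Re (dot (simple_fun (s n) x) z)| <= r n x * rnorm z.
  by rewrite -raddfB -dotNl -dotDl; exact: Re_dot_le.
have ir n : (\int[mu]_x (r n x)%:E < +oo)%E ->
    mu.-integrable [set: T] (EFin \o r n).
  move=> rn; apply/integrableP; split; first exact/measurable_EFinP.
  by under eq_integral do rewrite /= ger0_norm//.
have ifz n : (\int[mu]_x (r n x)%:E < +oo)%E ->
    mu.-integrable [set: T] (fun x => (complex.Re (dot (f x) z))%:E).
  move=> /ir irn; have [isn _] := Re_dot_simple z (hs n).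
  apply: (@le_integrable _ _ _ mu _ measurableT _ (fun x =>
      `|(complex.Re (dot (simple_fun (s n) x) z))%:E| +
      (rnorm z)%:E * (r n x)%:E)%E); first exact/measurable_EFinP.
    move=> x _; rewrite -EFinM -EFinD lee_fin.
    rewrite [leRHS]ger0_norm ?addr_ge0 ?mulr_ge0 ?rnorm_ge0//.
    rewrite -lerBlDl; apply: le_trans (lerB_dist _ _) _.
    by rewrite [rnorm z * _]mulrC.
  apply: integrableD => //; first exact: integrable_abse.
  by apply: integrableZl => //; exact: ir.
have bound n : (\int[mu]_x (r n x)%:E < +oo)%E ->
    `|Rintegral mu [set: T] (fun x => complex.Re (dot (f x) z)) -
      complex.Re (dot (simple_integral mu (s n)) z)| <=
    fine (\int[mu]_x (r n x)%:E) * rnorm z.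
  move=> rn; have [isn ->] := Re_dot_simple z (hs n).
  rewrite -RintegralB//; last exact: ifz rn.
  have idiff : mu.-integrable [set: T] (EFin \o (fun x =>
      complex.Re (dot (f x) z) - complex.Re (dot (simple_fun (s n) x) z))).
    exact: (integrableB measurableT (ifz n rn) isn).
  apply: (le_trans (le_normr_Rintegral _ _)) => //.
  rewrite -RintegralZr//; last exact: ir.
  apply: le_Rintegral => //.
  - exact: integrable_norm.
  - apply: (eq_integrable _ (fun x => (r n x)%:E * (rnorm z)%:E)%E) => //.
    by apply: integrableZr => //; exact: ir.
have near_fin : \forall n \near \oo, (\int[mu]_x (r n x)%:E < +oo)%E.
  by move/fine_cvgP : int0 => [h _]; apply: filterS h => n; rewrite ltey_eq => ->.
split; first by have [n _ /(_ n (leqnn n))/ifz] := near_fin.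
apply/eqP; rewrite -subr_eq0 -normr_eq0 eq_le normr_ge0 andbT.
have zp : 0 < rnorm z + 1 by rewrite ltr_wpDl// rnorm_ge0.
apply/ler_addgt0Pr => e e0; rewrite add0r.
have e1 : 0 < e / 2 / (rnorm z + 1) by rewrite !divr_gt0.
have {}int0 : \forall n \near \oo,
    fine (\int[mu]_x (r n x)%:E) < e / 2 / (rnorm z + 1).
  move/fine_cvgP : int0 => [_ /cvgrPdist_lt/(_ _ e1)]; apply: filterS => n.
  by rewrite sub0r normrN; apply: le_lt_trans; exact: ler_norm.
have sw' := near_rnormB sw e1.
have [n [[h1 h2] h3]] : exists n, ((\int[mu]_x (r n x)%:E < +oo)%E /\
    fine (\int[mu]_x (r n x)%:E) < e / 2 / (rnorm z + 1)) /\
    rnorm (w - simple_integral mu (s n)) < e / 2 / (rnorm z + 1).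
  have [n _ /(_ n (leqnn n))] := filterI (filterI near_fin int0) sw'.
  by exists n.
have := bound n h1; have := Re_dot_le (w - simple_integral mu (s n)) z.
rewrite ltr_pdivlMr// in h2; rewrite ltr_pdivlMr// in h3.
rewrite dotDl dotNl raddfB/=.
have := rnorm_ge0 z; have := rnorm_ge0 (w - simple_integral mu (s n)).
have : 0 <= fine (\int[mu]_x (r n x)%:E).
  by rewrite fine_ge0// integral_ge0// => x _; rewrite lee_fin.
move: h2 h3; move: (fine _) (rnorm z) (rnorm _) => a b c.
move: (Rintegral _ _ _) (complex.Re _) (complex.Re _) => J x y h2 h3 a0 c0 b0.
rewrite !ler_norml => /andP[? ?] /andP[? ?]; apply/andP; split; nra.
Qed.

End StrongMeasurability.
(** * The quotient space of square integrable functions *)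

Section L2Space.
Context d (T : measurableType d) (R : realType).
Variable mu : {measure set T -> \bar R}.
Context {E : hilbertType R}.
Implicit Types (f g : L2 mu (E := E)).

Lemma repr_L2fun f : (repr f : T -> E) \in L2fun mu.
Proof. by case: (repr f). Qed.

Lemma L2_ae_eq f g : {ae mu, forall x, repr f x = repr g x} -> f = g.
Proof.
move=> fg; rewrite -[f]reprK -[g]reprK; apply/eqP.
rewrite -Quotient.idealrBE; apply/mem_set => /=.
apply: filterS fg => x fgx.
suff : repr f x - repr g x = 0 by [].
by rewrite fgx subrr.
Qed.

Lemma repr_pi (f : L2pre mu (E := E)) :
  {ae mu, forall x, repr (\pi_(L2 mu (E := E)) f) x = f x}.
Proof.
have : repr (\pi_(L2 mu (E := E)) f) == f %[mod L2 mu (E := E)] by rewrite reprK.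
rewrite -Quotient.idealrBE => /set_mem; apply: filterS => x fx.
by apply/eqP; rewrite -subr_eq0; apply/eqP.
Qed.

Lemma L2class_ae (f : T -> E) : f \in L2fun mu ->
  {ae mu, forall x, repr (L2class mu f) x = f x}.
Proof.
move=> hf; have := repr_pi (insubd (0 : L2pre mu (E := E)) f).
have e : (insubd (0 : L2pre mu (E := E)) f : T -> E) = f := insubdK 0 hf.
by apply: filterS => x; rewrite /L2class => ->; rewrite e.
Qed.

Lemma L2classK f (h : T -> E) : h \in L2fun mu ->
  {ae mu, forall x, h x = repr f x} -> L2class mu h = f.
Proof.
move=> hL hf; apply: L2_ae_eq.
by apply: filterS2 (L2class_ae hL) hf => x -> ->.
Qed.

Lemma repr_scale (a : R[i]) f : {ae mu, forall x, repr (a *: f) x =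
  a *: repr f x}.
Proof. exact: (repr_pi (a *: repr f)). Qed.

Lemma repr_add f g : {ae mu, forall x, repr (f + g) x =
  repr f x + repr g x}.
Proof.
have e : f + g = \pi_(L2 mu (E := E)) (repr f + repr g).
  rewrite raddfD; congr (_ + _); apply: esym; [exact: (reprK f)|exact: (reprK g)].
by rewrite e; exact: repr_pi.
Qed.

Definition L2sq (f : T -> E) : R :=
  Rintegral mu [set: T] (fun x => rnorm (f x) ^+ 2).

Lemma L2sq_ge0 (f : T -> E) : 0 <= L2sq f.
Proof. by apply: Rintegral_ge0 => x _; exact: sqr_ge0. Qed.

Lemma measurable_rnorm2 (f : T -> E) : strongly_measurable mu f ->
  measurable_fun [set: T] (fun x => rnorm (f x) ^+ 2).
Proof. by move=> mf; apply: measurable_funX; exact: measurable_rnorm mf. Qed.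

Lemma L2fun_integrable (f : T -> E) : f \in L2fun mu ->
  mu.-integrable [set: T] (EFin \o (fun x => rnorm (f x) ^+ 2)).
Proof.
move=> /L2funP[mf fi]; apply/integrableP; split.
  exact/measurable_EFinP/measurable_rnorm2.
by under eq_integral do rewrite /= ger0_norm ?sqr_ge0//.
Qed.

Lemma L2sq_ae_eq (f g : T -> E) :
  strongly_measurable mu f -> strongly_measurable mu g ->
  {ae mu, forall x, f x = g x} -> L2sq f = L2sq g.
Proof.
move=> mf mg fg; congr fine; apply: ae_eq_integral => //.
- exact/measurable_EFinP/measurable_rnorm2.
- exact/measurable_EFinP/measurable_rnorm2.
by apply: filterS fg => x fgx _; rewrite /= fgx.
Qed.

Lemma strongly_measurable_repr f : strongly_measurable mu (repr f).
Proof. by have /L2funP[] := repr_L2fun f. Qed.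

Lemma L2sqZ (a : R[i]) f : L2sq (repr (a *: f)) = normc a ^+ 2 * L2sq (repr f).
Proof.
have /L2funP[mf _] := repr_L2fun f.
rewrite (L2sq_ae_eq _ _ (repr_scale a f)).
- rewrite /L2sq -RintegralZl//; last exact/L2fun_integrable/repr_L2fun.
  by apply: eq_Rintegral => x _; rewrite rnormZc exprMn.
- exact: strongly_measurable_repr.
rewrite (_ : (fun x => _) = a *: (repr f : T -> E) + 0); last first.
  by apply/funext => x; rewrite !fctE addr0.
by apply: strongly_measurable_lin => //; exact: strongly_measurable0.
Qed.

Lemma L2sqD (s : R) f g : 0 < s -> L2sq (repr (f + g)) <=
  (1 + s) * L2sq (repr f) + (1 + s^-1) * L2sq (repr g).
Proof.
move=> s0; have mf := strongly_measurable_repr f.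
have mg := strongly_measurable_repr g.
have intf := L2fun_integrable (repr_L2fun f).
have intg := L2fun_integrable (repr_L2fun g).
have intZ c (h : T -> R) : mu.-integrable [set: T] (EFin \o h) ->
    mu.-integrable [set: T] (EFin \o (fun x => c * h x)).
  by move=> ih; apply: (eq_integrable _ (fun x => c%:E * (h x)%:E)%E) => //;
    exact: integrableZl.
have mfg : strongly_measurable mu (fun x => repr f x + repr g x).
  rewrite (_ : (fun x => _) = 1 *: (repr f : T -> E) + (repr g : T -> E)).
    exact: strongly_measurable_lin.
  by apply/funext => x; rewrite !fctE scale1r.
have i1 := intZ (1 + s) _ intf; have i2 := intZ (1 + s^-1) _ intg.
have i12 : mu.-integrable [set: T] (EFin \o (fun x =>
    (1 + s) * rnorm (repr f x) ^+ 2 +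
    (1 + s^-1) * rnorm (repr g x) ^+ 2)).
  exact: (integrableD measurableT i1 i2).
rewrite (L2sq_ae_eq _ mfg (repr_add f g)); last exact: strongly_measurable_repr.
rewrite /L2sq -!RintegralZl// -RintegralD//.
apply: le_Rintegral => //; last by move=> x _; exact: ler_rnormD_weighted.
apply: le_integrable i12 => //.
  exact/measurable_EFinP/measurable_rnorm2.
move=> x _; rewrite /= lee_fin ger0_norm ?sqr_ge0//.
by apply: le_trans (ler_norm _); exact: ler_rnormD_weighted.
Qed.

Lemma Re_L2dotxx f : complex.Re (L2dot f f) = L2sq (repr f).
Proof. by apply: eq_Rintegral => x _; exact: Re_dotxx. Qed.

Lemma L2sq_null (f : T -> E) : {ae mu, forall x, f x = 0} ->
  strongly_measurable mu f -> L2sq f = 0.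
Proof.
move=> f0 mf; rewrite (L2sq_ae_eq mf (strongly_measurable0 mu) f0).
rewrite /L2sq /Rintegral (eq_integral (cst 0%E)) ?integral0// => x _.
by rewrite rnorm0 expr0n.
Qed.

End L2Space.

(** * Integrals of the weight *)

Section ScalarIntegrals.
Context {R : realType}.
Let mu : {measure set (measurableTypeR R) -> \bar R} := @lebesgue_measure R.

Lemma measurable_inv_ge0 (g : R -> R) : measurable_fun [set: R] g ->
  (forall x, 0 <= g x) -> measurable_fun [set: R] (fun x => (g x)^-1).
Proof.
move=> mg g0; rewrite (_ : (fun x => _) = (fun x => g x `^ (-1))).
  exact: (measurableT_comp (measurable_powR _)).
by apply/funext => x; rewrite powR_inv1.
Qed.

(** An even function that is comparable to |x|^(c-1) near 0 and to |x|^(-c-1) at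
    infinity; on the positive half-line it is the derivative of the bounded
    function -1/(1 + x^c), hence it is integrable. *)
Definition bump (c x : R) : R := c * `|x| `^ (c - 1) / (1 + `|x| `^ c) ^+ 2.

Lemma bump_ge0 c x : 0 <= c -> 0 <= bump c x.
Proof. by move=> c0; rewrite !mulr_ge0 ?powR_ge0// invr_ge0 sqr_ge0. Qed.

Lemma measurable_bump c : measurable_fun [set: R] (bump c).
Proof.
have mp a : measurable_fun [set: R] (fun x : R => `|x| `^ a).
  by apply: (measurableT_comp (measurable_powR _)); exact: normr_measurable.
apply: measurable_funM; first exact: measurable_funM.
apply: measurable_inv_ge0 => [|x]; last exact: sqr_ge0.
by apply: measurable_funX; exact: measurable_funD.
Qed.

Lemma is_derive_bump_primitive (c x : R) : 0 < x ->
  is_derive x 1 (fun y => - (1 + y `^ c)^-1) (bump c x).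
Proof.
move=> x0; have dp := is_derive1_powR c x0.
have n0 : 1 + x `^ c != 0 by rewrite gt_eqF// ltr_pwDl// powR_ge0.
have d1 : is_derive x 1 (fun y => 1 + y `^ c) (c * x `^ (c - 1)).
  by rewrite -[X in is_derive _ _ _ X]add0r; apply: is_deriveD.
have d2 := is_deriveN (@is_deriveV _ (fun y : R => 1 + y `^ c) x _ 1 n0 d1).
apply: is_derive_eq d2 _.
by rewrite /bump ger0_norm ?ltW// scaleNr opprK /GRing.scale/= mulrC.
Qed.

Lemma continuous_bump c x : 0 < x -> {for x, continuous (bump c)}.
Proof.
move=> x0.
have cp a : {for x, continuous (fun y : R => `|y| `^ a)}.
  apply: (@continuous_comp _ _ _ (fun y : R => `|y|) (fun y => y `^ a)).
    exact: norm_continuous.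
  rewrite ger0_norm ?ltW//; apply/differentiable_continuous/derivable1_diffP.
  exact: (@ex_derive _ _ _ _ _ _ _ (is_derive1_powR a x0)).
apply: continuousM; first by apply: continuousM => //; exact: cst_continuous.
apply: continuousV.
  by rewrite expf_neq0// gt_eqF// ltr_pwDl// powR_ge0.
apply: (@continuous_comp _ _ _ (fun y : R => 1 + `|y| `^ c) (fun y => y ^+ 2)).
  by apply: continuousD => //; exact: cst_continuous.
exact: exprn_continuous.
Qed.

Lemma integral_bump_pos (c l r : R) : 0 < l -> l < r ->
  (\int[mu]_(x in `[l, r]) (bump c x)%:E <= 1%:E)%E.
Proof.
move=> l0 lr.
pose F y : R := - (1 + y `^ c)^-1.
have dF y : l <= y -> is_derive y 1 F (bump c y).
  by move=> ly; apply: is_derive_bump_primitive; exact: lt_le_trans l0 ly.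
have cF y : l <= y -> {for y, continuous F}.
  move=> /dF h; apply/differentiable_continuous/derivable1_diffP.
  exact: (@ex_derive _ _ _ _ _ _ _ h).
rewrite (@continuous_FTC2 _ _ F)//.
- rewrite -EFinB lee_fin /F.
  have h z : 0 < (1 + z `^ c)^-1 <= 1.
    by rewrite invr_gt0 invf_le1 ltr_pwDl ?powR_ge0//= lerDl powR_ge0.
  by have := h l; have := h r; lra.
- apply: continuous_in_subspaceT => x; rewrite inE/= in_itv/= => /andP[lx _].
  by apply: continuous_bump; exact: lt_le_trans l0 lx.
- split.
  + move=> x; rewrite in_itv/= => /andP[lx _].
    exact: (@ex_derive _ _ _ _ _ _ _ (dF _ (ltW lx))).
  + by apply: cvg_at_right_filter; exact: cF.
  + by apply: cvg_at_left_filter; apply: cF; exact: ltW.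
- move=> x; rewrite in_itv/= => /andP[lx _].
  by rewrite derive1E; have := dF x (ltW lx) => h; rewrite derive_val.
Qed.

Lemma integral_bump_neg (c l r : R) : 0 < l -> l < r ->
  (\int[mu]_(x in `[(- r)%R, (- l)%R]) (bump c x)%:E <= 1%:E)%E.
Proof.
move=> l0 lr; rewrite integration_by_substitution_oppr ?(ltW lr)//; last first.
  apply: continuous_in_subspaceT => x; rewrite inE/= in_itv/= => /andP[_ xl].
  rewrite (_ : bump c = bump c \o -%R); last first.
    by apply/funext => y; rewrite /bump /= normrN.
  apply: continuous_comp; first exact: oppr_continuous.
  apply: continuous_bump; rewrite oppr_gt0; apply: le_lt_trans xl _.
  by rewrite oppr_lt0.
apply: le_trans (integral_bump_pos c l0 lr).
by under eq_integral do rewrite /bump /= normrN.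
Qed.

Lemma integral_bump_lty c : 0 <= c -> (\int[mu]_x (bump c x)%:E < +oo)%E.
Proof.
move=> c0.
pose l n : R := n.+2%:R^-1; pose r n : R := n.+2%:R.
have l0 n : 0 < l n by rewrite invr_gt0.
have lr n : l n < r n.
  apply: (@lt_trans _ _ 1); first by rewrite invf_lt1// ltr1n.
  by rewrite ltr1n.
pose P n := `[l n, r n]%classic; pose M n := `[- r n, - l n]%classic.
have mb (D : set R) : measurable_fun D (fun x => (bump c x)%:E).
  by apply/measurable_EFinP; apply: measurable_funS (measurable_bump c).
have b0 x : (0 <= (bump c x)%:E)%E by rewrite lee_fin bump_ge0.
have ndl i j : (i <= j)%N -> l j <= l i.
  by move=> ij; rewrite lef_pV2 ?posrE// ler_nat.
have ndr i j : (i <= j)%N -> r i <= r j by move=> ij; rewrite ler_nat.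
have ndP : nondecreasing_seq P.
  move=> i j ij; rewrite subsetEset => x; rewrite /P /= !in_itv/=.
  by have := ndl i j ij; have := ndr i j ij => *; lra.
have ndM : nondecreasing_seq M.
  move=> i j ij; rewrite subsetEset => x; rewrite /M /= !in_itv/=.
  by have := ndl i j ij; have := ndr i j ij => *; lra.
have bound (F : (set R)^nat) : nondecreasing_seq F ->
    (forall n, measurable (F n)) ->
    (forall n, (\int[mu]_(x in F n) (bump c x)%:E <= 1%:E)%E) ->
    (\int[mu]_(x in \bigcup_n F n) (bump c x)%:E <= 1%:E)%E.
  move=> ndF mF hF.
  have := @ge0_nondecreasing_set_cvg_integral _ (measurableTypeR R) R F
    (fun x => (bump c x)%:E) mu
    ndF mF (fun=> mb _) (fun _ x _ => b0 x).
  move=> /cvge_to_le; apply; exact: nearW.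
have mP n : measurable (P n) by exact: measurable_itv.
have mM n : measurable (M n) by exact: measurable_itv.
have bP := bound P ndP mP (fun n => integral_bump_pos c (l0 n) (lr n)).
have bM := bound M ndM mM (fun n => integral_bump_neg c (l0 n) (lr n)).
have mUP : measurable (\bigcup_n P n) by exact: bigcup_measurable.
have mUM : measurable (\bigcup_n M n) by exact: bigcup_measurable.
have cover : [set: R] = ((\bigcup_n P n) `|` (\bigcup_n M n)) `|` [set 0].
  have key (y : R) : 0 < y -> exists n, l n <= y <= r n.
    move=> y0; pose n := Num.truncn (y + y^-1).
    have yn : y + y^-1 < n.+2%:R.
      by apply: (@lt_trans _ _ n.+1%:R); rewrite ?ltr_nat// truncnS_gt.
    have yi : 0 < y^-1 by rewrite invr_gt0.
    exists n; apply/andP; split; last by rewrite /r; lra.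
    rewrite /l invf_ple ?posrE//; lra.
  apply/seteqP; split => // y _.
  have [y0|y0|->] := ltgtP y 0; last by right.
  - left; right; have [|n /andP[h1 h2]] := key (- y); first by rewrite oppr_gt0.
    by exists n => //; rewrite /M /= in_itv/=; lra.
  - left; left; have [//|n /andP[h1 h2]] := key y.
    by exists n => //; rewrite /P /= in_itv/=; lra.
have memP x : (\bigcup_n P n) x -> 0 < x.
  by move=> [n _]; rewrite /P /= in_itv/= => /andP[+ _]; apply: lt_le_trans.
have memM x : (\bigcup_n M n) x -> x < 0.
  move=> [n _]; rewrite /M /= in_itv/= => /andP[_ h].
  by apply: (le_lt_trans h); rewrite oppr_lt0.
have mUU := measurableU _ _ mUP mUM.
rewrite cover (@ge0_integral_setU _ (measurableTypeR R) R mu _ _ mUU)//;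
  last 2 first.
  exact: (mb _).
  rewrite disj_set2E; apply/eqP/seteqP.
  split => // x [[/memP|/memM] /[swap] ->];
  by rewrite ltxx.
rewrite (@ge0_integral_setU _ (measurableTypeR R) R mu _ _ mUP mUM)//;
  last 2 first.
  exact: (mb _).
  rewrite disj_set2E; apply/eqP/seteqP; split => // x [/memP h1 /memM h2].
  by have := lt_trans h1 h2; rewrite ltxx.
rewrite integral_set1 adde0.
by apply: (@le_lt_trans _ _ (1%:E + 1%:E)%E); [exact: leeD|rewrite -EFinD ltry].
Qed.


Lemma weightE (a x : R) : x != 0 -> weight a x ^+ 2 = `|x| `^ (2 * a - 1).
Proof.
move=> x0; rewrite /weight expr2 -powRD; last by rewrite normr_eq0 x0 implybT.
by congr (_ `^ _); lra.
Qed.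

Lemma measurable_weight (a : R) : measurable_fun [set: R] (weight a).
Proof.
by apply: (measurableT_comp (measurable_powR _)); exact: normr_measurable.
Qed.

(** The exponent c = 2 a (1 - a) is at most 2 a and at most 2 (1 - a), which is
    what the singularity |x|^(2a-1) at 0 and the decay |x|^(2a-3) at infinity
    require; it is positive because 0 < a < 1. *)
Lemma weight_le_bump (a s x C : R) : 0 < a -> a < 1 -> x != 0 ->
  0 <= s -> s <= C -> s * x ^+ 2 <= C ->
  weight a x ^+ 2 * s <= 4 * C / (2 * a * (1 - a)) * bump (2 * a * (1 - a)) x.
Proof.
move=> a0 a1 x0 s0 sC sxC; rewrite weightE//.
set c := 2 * a * (1 - a); set y := `|x|.
have c0 : 0 < c by rewrite !mulr_gt0// subr_gt0.
have y0 : 0 < y by rewrite normr_gt0.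
have yc0 := powR_ge0 y c.
have sy : s * y ^+ 2 <= C by rewrite -normrX ger0_norm ?sqr_ge0.
rewrite /bump -/y.
have -> : 4 * C / c * (c * y `^ (c - 1) / (1 + y `^ c) ^+ 2) =
    4 * C * y `^ (c - 1) / (1 + y `^ c) ^+ 2.
  by field; rewrite (gt_eqF c0) gt_eqF// ltr_pwDl.
rewrite ler_pdivlMr; last by rewrite exprn_gt0// ltr_pwDl.
have -> : y `^ (2 * a - 1) = y `^ (c - 1) * y `^ (2 * a ^+ 2).
  rewrite -powRD; last by rewrite (gt_eqF y0) implybT.
  by congr (_ `^ _); rewrite /c; ring.
have -> : y `^ (c - 1) * y `^ (2 * a ^+ 2) * s * (1 + y `^ c) ^+ 2 =
    (s * y `^ (2 * a ^+ 2) * (1 + y `^ c) ^+ 2) * y `^ (c - 1) by ring.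
rewrite ler_wpM2r ?powR_ge0//.
have a20 : 0 <= 2 * a ^+ 2 by rewrite mulr_ge0// sqr_ge0.
have [y1|y1] := leP y 1.
  have h (p : R) : 0 <= p -> y `^ p <= 1.
    by move=> p0; rewrite -[leRHS](powRr0 y) ger_powR// y0.
  have hc := h _ (ltW c0); have ha := h _ a20; have pa := powR_ge0 y (2 * a ^+ 2).
  have h1 : s * y `^ (2 * a ^+ 2) <= C.
    by rewrite -[C]mulr1; apply: ler_pM.
  have h2 : (1 + y `^ c) ^+ 2 <= 4 by nra.
  have h3 : 0 <= s * y `^ (2 * a ^+ 2) by rewrite mulr_ge0.
  by rewrite [4 * C]mulrC; apply: ler_pM => //; exact: sqr_ge0.
have hc : 1 <= y `^ c by rewrite -[leLHS](powRr0 y) ler_powR// ltW.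
have h2 : (1 + y `^ c) ^+ 2 <= 4 * (y `^ c) ^+ 2 by nra.
have h3 : y `^ (2 * a ^+ 2) * (y `^ c) ^+ 2 <= y ^+ 2.
  rewrite -(powR_mulrn 2 yc0) -(powR_mulrn 2 (ltW y0)) -powRrM.
  rewrite -powRD; last by rewrite (gt_eqF y0) implybT.
  by apply: ler_powR; [exact: ltW|rewrite /c; nra].
apply: (@le_trans _ _ (4 * (s * (y `^ (2 * a ^+ 2) * (y `^ c) ^+ 2)))).
  rewrite (_ : 4 * _ = s * y `^ (2 * a ^+ 2) * (4 * (y `^ c) ^+ 2)); last by ring.
  by rewrite ler_wpM2l// mulr_ge0// powR_ge0.
by rewrite ler_wpM2l//; apply: le_trans sy; rewrite ler_wpM2l.
Qed.

Lemma ae_neq0 : {ae mu, forall x : measurableTypeR R, x != 0 :> R}.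
Proof.
exists [set 0]; split => //; first exact: lebesgue_measure_set1.
by move=> x /= /negP; rewrite negbK => /eqP.
Qed.

Lemma integrable_bump (k c : R) : 0 <= c ->
  mu.-integrable [set: R] (fun x => (k * bump c x)%:E).
Proof.
move=> c0.
have ib : mu.-integrable [set: R] (fun x => (bump c x)%:E).
  apply/integrableP; split.
    by apply/measurable_EFinP; exact: measurable_bump.
  under eq_integral do rewrite /= ger0_norm ?bump_ge0//.
  exact: integral_bump_lty.
exact: (integrableZl measurableT k ib).
Qed.

Lemma weight_integrable (a C : R) (s : R -> R) : 0 < a -> a < 1 ->
  measurable_fun [set: R] s -> (forall x, 0 <= s x) -> (forall x, s x <= C) ->
  (forall x, s x * x ^+ 2 <= C) ->
  mu.-integrable [set: R] (fun x => (weight a x ^+ 2 * s x)%:E).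
Proof.
move=> a0 a1 ms s0 sC sxC.
have ws0 x : 0 <= weight a x ^+ 2 * s x by rewrite mulr_ge0 ?sqr_ge0.
have c0 : 0 <= 2 * a * (1 - a) by apply: mulr_ge0; lra.
have mws : measurable_fun [set: R] (fun x => (weight a x ^+ 2 * s x)%:E).
  apply/measurable_EFinP; apply: measurable_funM => //.
  by apply: measurable_funX; exact: measurable_weight.
have C0 : 0 <= C by exact: le_trans (s0 0) (sC 0).
apply/integrableP; split => //.
under eq_integral do rewrite /= ger0_norm//.
have /integrableP[mb ib] := integrable_bump (4 * C / (2 * a * (1 - a))) c0.
apply: le_lt_trans ib; apply: ae_ge0_le_integral => //.
- by move=> x _; rewrite lee_fin.
- exact: measurableT_comp mb.
apply: filterS ae_neq0 => x x0 _; rewrite lee_fin.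
by apply: le_trans (ler_norm _); exact: weight_le_bump.
Qed.

(** Twice this number bounds the integral of p(x)^2 / |i w + x^2 + eta| for
    |w| >= n + 1.  It tends to 0, which is why oscillations of high frequency are
    hardly damped. *)
Definition decay (a : R) (n : nat) : R :=
  Rintegral mu [set: R] (fun x => weight a x ^+ 2 * (n.+1%:R + x ^+ 2)^-1).

Lemma measurable_decay (r : R) : 0 <= r ->
  measurable_fun [set: R] (fun x : R => (r + x ^+ 2)^-1).
Proof.
move=> r0; apply: measurable_inv_ge0 => [|x]; last by rewrite addr_ge0 ?sqr_ge0.
by apply: measurable_funD => //; exact: exprn_measurable.
Qed.

Lemma decay_kernel (n : nat) (x : R) : [/\ 0 <= (n.+1%:R + x ^+ 2)^-1,
  (n.+1%:R + x ^+ 2)^-1 <= 1 & (n.+1%:R + x ^+ 2)^-1 * x ^+ 2 <= 1].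
Proof.
have n1 : 1 <= n.+1%:R :> R by rewrite ler1n.
have x2 := sqr_ge0 x.
have p : 0 < n.+1%:R + x ^+ 2 by lra.
split; first by rewrite invr_ge0 ltW.
  by rewrite invf_le1//; lra.
by rewrite mulrC ler_pdivrMr//; lra.
Qed.

Lemma decay_integrable (a : R) n : 0 < a -> a < 1 ->
  mu.-integrable [set: R] (fun x => (weight a x ^+ 2 * (n.+1%:R + x ^+ 2)^-1)%:E).
Proof.
move=> a0 a1; apply: (@weight_integrable a 1) => //.
- exact: measurable_decay.
- by move=> x; have [] := decay_kernel n x.
- by move=> x; have [] := decay_kernel n x.
- by move=> x; have [] := decay_kernel n x.
Qed.

Lemma cvg_decay (a : R) : 0 < a -> a < 1 -> decay a n @[n --> \oo] --> (0 : R).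
Proof.
move=> a0 a1.
have c0 : 0 <= 2 * a * (1 - a) by apply: mulr_ge0; lra.
pose g x : \bar R := (4 * 1 / (2 * a * (1 - a)) * bump (2 * a * (1 - a)) x)%:E.
have ig : mu.-integrable [set: R] g := integrable_bump _ c0.
have [|||||_ _] := @dominated_convergence _ (measurableTypeR R) R mu [set: R]
  measurableT (fun n x => (weight a x ^+ 2 * (n.+1%:R + x ^+ 2)^-1)%:E) (cst 0%E) g.
- by move=> n; have /integrableP[] := decay_integrable n a0 a1.
- exact: measurable_cst.
- apply: nearW => x _; apply: cvg_EFin; first exact: nearW.
  rewrite -[X in _ --> X](mulr0 (weight a x ^+ 2)); apply: cvgMl_tmp.
  apply: (squeeze_cvgr _ (cvg_cst 0) (@cvg_harmonic R)); apply: nearW => n.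
  have [-> _ _] := decay_kernel n x.
  by rewrite /= lef_pV2 ?posrE ?lerDl ?sqr_ge0// ltr_wpDr ?sqr_ge0.
- exact: ig.
- apply: filterS ae_neq0 => x x0 n _; rewrite lee_fin.
  have [k0 k1 k2] := decay_kernel n x.
  have w0 : 0 <= weight a x ^+ 2 := sqr_ge0 _.
  by rewrite (ger0_norm (mulr_ge0 w0 k0)); exact: weight_le_bump.
rewrite integral0 => h.
by have /fine_cvgP[_] := h.
Qed.

End ScalarIntegrals.

(** * The energy space and the square root of the operator *)

Section QuadraticSeminorm.
Context {R : realType} {V : lmodType R[i]}.

(** Minimising (1 + s) Q(x) + (1 + 1/s) Q(y) over s > 0 gives the square of
    sqrt(Q(x)) + sqrt(Q(y)); the optimal s is the ratio of the two roots, here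
    shifted by e/2 to avoid a division by 0. *)
Lemma seminorm_sqrt (Q : V -> R) :
  (forall x, 0 <= Q x) ->
  (forall (a : R[i]) x, Q (a *: x) = normc a ^+ 2 * Q x) ->
  (forall (s : R) x y, 0 < s -> Q (x + y) <= (1 + s) * Q x + (1 + s^-1) * Q y) ->
  seminorm (fun x => Num.sqrt (Q x)).
Proof.
move=> Q0 QZ QD; split=> [x y|a x]; last first.
  by rewrite QZ sqrtrM ?sqr_ge0// sqrtr_sqr ger0_norm ?normc_ge0.
apply/ler_addgt0Pr => e e0.
have p0 := sqrtr_ge0 (Q x); have q0 := sqrtr_ge0 (Q y).
have pE := sqr_sqrtr (Q0 x); have qE := sqr_sqrtr (Q0 y).
set p := Num.sqrt (Q x) in p0 pE *; set q := Num.sqrt (Q y) in q0 qE *.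
pose p' := p + e / 2; pose q' := q + e / 2.
have p'0 : 0 < p' by rewrite /p'; lra.
have q'0 : 0 < q' by rewrite /q'; lra.
have -> : p + q + e = p' + q' by rewrite /p' /q'; lra.
have pq0 : 0 <= p' + q' by lra.
rewrite -[leRHS](ger0_norm pq0) -[leRHS]sqrtr_sqr ler_wsqrtr//.
apply: (le_trans (QD (q' / p') x y (divr_gt0 q'0 p'0))).
have -> : (p' + q') ^+ 2 =
    (1 + q' / p') * p' ^+ 2 + (1 + (q' / p')^-1) * q' ^+ 2.
  by field; rewrite !gt_eqF.
have pp : p ^+ 2 <= p' ^+ 2 by rewrite ler_pXn2r ?nnegrE ?(ltW p'0)// /p'; lra.
have qq : q ^+ 2 <= q' ^+ 2 by rewrite ler_pXn2r ?nnegrE ?(ltW q'0)// /q'; lra.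
have r0 : 0 < q' / p' by rewrite divr_gt0.
rewrite -pE -qE; apply: lerD; apply: ler_wpM2l => //.
  by rewrite addr_ge0// ltW.
by rewrite addr_ge0// invr_ge0 ltW.
Qed.

End QuadraticSeminorm.

Section HalfSpace.
Context {R : realType} {H : hilbertType R}.
Variable S : linear_op H H.
Implicit Types u v z : half_space S.

Lemma half_dom z : pdom S (half_val z).
Proof. by apply: set_mem; case: z. Qed.

Lemma half_op_lin a u v :
  S (half_val (a *: u + v)) = a *: S (half_val u) + S (half_val v).
Proof. by apply: papp_linear; exact: half_dom. Qed.

Lemma half_op0 : S (half_val (0 : half_space S)) = 0.
Proof.
have := half_op_lin (-1) 0 0; rewrite scaler0 addr0 => {1}->.
by rewrite scaleN1r addNr.
Qed.

Lemma half_opZ a u : S (half_val (a *: u)) = a *: S (half_val u).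
Proof. by rewrite -[a *: u]addr0 half_op_lin half_op0 addr0. Qed.

Lemma half_opD u v : S (half_val (u + v)) = S (half_val u) + S (half_val v).
Proof. by rewrite -[u]scale1r half_op_lin !scale1r. Qed.

Lemma half_val_inj u v : half_val u = half_val v -> u = v.
Proof. exact: val_inj. Qed.

Lemma to_halfE (x : H) : pdom S x -> half_val (to_half S x) = x.
Proof. by move=> Sx; apply: insubdK; apply/mem_set. Qed.

Lemma to_half_val u : to_half S (half_val u) = u.
Proof. by apply: half_val_inj; rewrite to_halfE//; exact: half_dom. Qed.

End HalfSpace.

Section SquareRoot.
Context {R : realType} {H : hilbertType R}.
Variables A S : linear_op H H.
Hypothesis S_sqrt : is_sqrt_op A S.

Let S_sa : selfadjoint S. Proof. by case: S_sqrt. Qed.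

(** H_(1/2), the domain of the square root, is dense in H, so a functional has at
    most one representative in the pivot space. *)
Lemma represents_inj (h h' : H) (f : dual_half_space S) :
  represents h f -> represents h' f -> h = h'.
Proof.
move=> hf hf'; apply/eqP; rewrite -subr_eq0; apply/negP => /negP d0.
set d := h - h' in d0.
have rd : 0 < `|d| by rewrite normr_gt0.
have [z [bz Sz]] :=
  S_sa.1 (ball d `|d|) (ex_intro _ d (ballxx d rd)) (ball_open d _).
have dz : dot d z = 0.
  pose z' := to_half S z; rewrite -[z](to_halfE Sz) /d dotDl dotNl.
  by rewrite -(hf z') -(hf' z') subrr.
have : dot d d = dot d (d - z) by rewrite dotDr dotNr dz subr0.
rewrite dot_norm => e.
have := cauchy_schwarz d (d - z); rewrite -e ger0_norm ?exprn_ge0//.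
rewrite expr2 ler_pM2l// => h1.
by move: bz; rewrite -ball_normE /ball_ /= => /(le_lt_trans h1); rewrite ltxx.
Qed.

Lemma pivot_reprE (h : H) (f : dual_half_space S) :
  represents h f -> pivot_repr f = h.
Proof.
move=> hf; apply: (represents_inj _ hf).
by rewrite /pivot_repr; case: xgetP => [y _ //|/(_ h)].
Qed.

Lemma sqrt_op_symmetric x y : pdom S x -> pdom S y -> dot (S x) y = dot x (S y).
Proof. by move=> Sx Sy; apply: ((S_sa.2 y (S y)).2 (conj Sy erefl)). Qed.

Lemma weak_op (x : H) (z : half_space S) : pdom A x ->
  dot (S x) (S (half_val z)) = dot (A x) (half_val z).
Proof.
case: S_sqrt => _ _ dA AE Ax; have [Sx SSx] := (dA x).1 Ax.
by rewrite -sqrt_op_symmetric// -?AE//; exact: half_dom.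
Qed.

(** A vector of the form domain that satisfies the weak equation lies in the
    domain of the operator: the weak equation says that S u belongs to the domain
    of the adjoint of S, which is S itself. *)
Lemma weak_op_dom (u : half_space S) (h : H) :
  (forall z : half_space S,
     dot (S (half_val u)) (S (half_val z)) = dot h (half_val z)) ->
  pdom A (half_val u) /\ A (half_val u) = h.
Proof.
case: S_sqrt => _ _ dA AE hu.
have [SSu SE] : pdom S (S (half_val u)) /\ S (S (half_val u)) = h.
  apply: (S_sa.2 _ _).1 => x Sx.
  by rewrite dotC [RHS]dotC -(to_halfE Sx) hu.
have Au : pdom A (half_val u) by apply: (dA _).2; split => //; exact: half_dom.
by rewrite AE.
Qed.

Lemma dom_lin (E F : lmodType R[i]) (L : linear_op E F) a x y :
  pdom L x -> pdom L y -> pdom L (a *: x + y).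
Proof.
move=> /mem_set Lx /mem_set Ly; have [_ h] := pdom_submod L.
by apply: set_mem; exact: h.
Qed.

Lemma dom0 (E F : lmodType R[i]) (L : linear_op E F) : pdom L 0.
Proof. by apply: set_mem; have [] := pdom_submod L. Qed.

Lemma linear_op0 (E F : lmodType R[i]) (L : linear_op E F) : L 0 = 0.
Proof.
have L0 := dom0 L; have := papp_linear (-1) L0 L0.
by rewrite scaleN1r addNr scaleN1r addNr.
Qed.

Lemma linear_opZ (E F : lmodType R[i]) (L : linear_op E F) a x :
  pdom L x -> L (a *: x) = a *: L x.
Proof.
by move=> Lx; rewrite -[a *: x]addr0 papp_linear ?linear_op0 ?addr0//; exact: dom0.
Qed.

Lemma dom_scale (E F : lmodType R[i]) (L : linear_op E F) a x :
  pdom L x -> pdom L (a *: x).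
Proof. by move=> Lx; rewrite -[a *: x]addr0; apply: dom_lin => //; exact: dom0. Qed.

(** For w = 0 the first line of the eigenvalue equation reads u = 0, and the mode
    would vanish; the second line is A u = w^2 u. *)
Lemma wave_eigenvector (w : R) (u : half_space S) :
  is_eigenvector (wave_op A S) (0 +i* w) (wave_mode w u) ->
  [/\ w != 0, pdom A (half_val u) & A (half_val u) = (w ^+ 2)%:C *: half_val u].
Proof.
move=> [/= [Au Su] x0]; rewrite /wave_mode /= => -[e1 e2].
have w0 : w != 0.
  apply/eqP => w0; move: e1; rewrite w0 (_ : 0 +i* 0 = 0)// scale0r.
  rewrite to_half_val => u0; apply: x0.
  by rewrite /wave_mode w0 u0 scaler0.
have i0 : (0 +i* w) != 0 by rewrite eq_complex /= negb_and w0 orbT.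
have {}Au : pdom A (half_val u).
  have := dom_scale (0 +i* w) Au.
  by rewrite [X in pdom A X](_ : _ = half_val u)//= scalerA mulfV// scale1r.
split => //; rewrite linear_opZ// in e2.
have := congr1 (fun y => - ((0 +i* w) *: y)) e2.
rewrite scalerN opprK !scalerA mulfV// scale1r -scaleNr => ->.
congr (_ *: _); apply/eqP.
by rewrite eq_complex /=; apply/andP; split; apply/eqP; ring.
Qed.

End SquareRoot.

(** * The energy norm *)

Section EnergyNorm.
Context {R : realType} {H U : hilbertType R}.
Variables (S : linear_op H H) (alpha : R).
Hypotheses (alpha_gt0 : 0 < alpha) (alpha_lt1 : alpha < 1).
Let mu : {measure set (measurableTypeR R) -> \bar R} := @lebesgue_measure R.
Implicit Types X Y : energy_space U S.

Lemma gamma_ge0 : 0 <= gamma alpha.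
Proof.
apply: divr_ge0; last exact: powR_ge0.
apply: mulr_ge0; last first.
  by apply: Rintegral_ge0 => x _; rewrite mulr_ge0 ?powR_ge0 ?expR_ge0.
rewrite mulr_ge0// sin_ge0_pi// mulr_ge0 ?pi_ge0 ?(ltW alpha_gt0)//=.
by rewrite ler_piMl ?pi_ge0// ltW.
Qed.

Definition energy_sq X : R :=
  rnorm (S (half_val X.1.1)) ^+ 2 + rnorm X.1.2 ^+ 2 +
  gamma alpha * L2sq mu (repr X.2).

Lemma energy_normE X : energy_norm alpha X = Num.sqrt (energy_sq X).
Proof.
rewrite /energy_norm /energy_dot /half_dot !dotxxE; congr Num.sqrt.
rewrite /energy_sq -(Re_L2dotxx (X.2 : L2 mu (E := U))).
by case: L2dot => a b /=; rewrite mul0r subr0.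
Qed.

Lemma energy_sq_ge0 X : 0 <= energy_sq X.
Proof.
by rewrite !addr_ge0 ?sqr_ge0// mulr_ge0 ?gamma_ge0// L2sq_ge0.
Qed.

Lemma seminorm_energy : seminorm (energy_norm alpha : energy_space U S -> R).
Proof.
rewrite (_ : energy_norm alpha = fun X => Num.sqrt (energy_sq X)); last first.
  by apply/funext => X; rewrite energy_normE.
apply: seminorm_sqrt => [X|a X|s X Y s0]; first exact: energy_sq_ge0.
  by rewrite /energy_sq /= half_opZ !rnormZc L2sqZ !exprMn; ring.
rewrite /energy_sq /= half_opD.
have h1 := ler_rnormD_weighted (S (half_val X.1.1)) (S (half_val Y.1.1)) s0.
have h2 := ler_rnormD_weighted X.1.2 Y.1.2 s0.
have h3 : gamma alpha * L2sq mu (repr (X.2 + Y.2)) <= gamma alpha *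
    ((1 + s) * L2sq mu (repr X.2) + (1 + s^-1) * L2sq mu (repr Y.2)).
  by rewrite ler_wpM2l ?gamma_ge0//; exact: L2sqD.
apply: (le_trans (lerD (lerD h1 h2) h3)).
by rewrite le_eqVlt; apply/orP; left; apply/eqP; ring.
Qed.

Lemma rnorm_half_le X : rnorm (S (half_val X.1.1)) <= energy_norm alpha X.
Proof.
rewrite energy_normE -[leLHS](ger0_norm (rnorm_ge0 _)) -sqrtr_sqr ler_wsqrtr//.
have g0 := mulr_ge0 gamma_ge0 (L2sq_ge0 mu (repr X.2)).
by rewrite /energy_sq -addrA lerDl addr_ge0// sqr_ge0.
Qed.

Lemma rnorm_pivot_le X : rnorm X.1.2 <= energy_norm alpha X.
Proof.
rewrite energy_normE -[leLHS](ger0_norm (rnorm_ge0 _)) -sqrtr_sqr ler_wsqrtr//.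
have g0 := mulr_ge0 gamma_ge0 (L2sq_ge0 mu (repr X.2)).
by rewrite /energy_sq addrAC lerDr addr_ge0// sqr_ge0.
Qed.

End EnergyNorm.

(** * The adjoint of the control operator *)

Section Adjoint.
Context {R : realType} {H U : hilbertType R} {S : linear_op H H}.
Variables (B : {linear U -> dual_half_space S}) (Bs : half_space S -> U).
Hypothesis Bs_adjoint : is_adjoint B Bs.

Lemma adjoint_lin a u v : Bs (a *: u + v) = a *: Bs u + Bs v.
Proof.
apply: dot_ext => z; rewrite dotC [RHS]dotC; congr (_^*).
rewrite -Bs_adjoint dotDr dotZr -!Bs_adjoint.
have /set_mem[h _] : (B z : half_space S -> R[i]) \in dual_pred (S := S).
  by case: (B z).
by [].
Qed.

Lemma adjoint0 : Bs 0 = 0.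
Proof.
have := adjoint_lin (-1) 0 0; rewrite scaler0 addr0 => {1}->.
by rewrite scaleN1r addNr.
Qed.

Lemma adjointZ a u : Bs (a *: u) = a *: Bs u.
Proof. by rewrite -[a *: u]addr0 adjoint_lin adjoint0 addr0. Qed.

End Adjoint.

(** * The diffusive component of a mode *)

Lemma sum_sqr_le (R : realFieldType) (m y v e : R) : 0 <= m -> 0 <= y -> 0 <= e ->
  m <= v -> (m + y) ^+ 2 <= 2 ^+ 2 * ((y + e) ^+ 2 + v ^+ 2).
Proof.
move=> m0 y0 e0 mv.
have h1 : (m + y) ^+ 2 <= (v + (y + e)) ^+ 2.
  by rewrite ler_pXn2r ?nnegrE//; lra.
have h2 : 0 <= (v - (y + e)) ^+ 2 by exact: sqr_ge0.
nra.
Qed.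

Section Profile.
Context {R : realType} {U : hilbertType R}.
Variables (alpha eta w : R).
Hypotheses (alpha_gt0 : 0 < alpha) (alpha_lt1 : alpha < 1) (eta_ge0 : 0 <= eta)
  (w_neq0 : w != 0).
Let mu : {measure set (measurableTypeR R) -> \bar R} := @lebesgue_measure R.

Definition res_den (x : R) : R := (x ^+ 2 + eta) ^+ 2 + w ^+ 2.

(** The complex number 1 / (i w + x^2 + eta), see [resolvent_symbolM]. *)
Definition resolvent_symbol (x : R) : R[i] :=
  ((x ^+ 2 + eta) / res_den x) +i* (- (w / res_den x)).

Lemma res_den_gt0 x : 0 < res_den x.
Proof. by rewrite ltr_wpDl ?sqr_ge0// exprn_even_gt0. Qed.

Lemma resolvent_symbolM x :
  ((x ^+ 2 + eta) +i* w) * resolvent_symbol x = 1.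
Proof.
have := res_den_gt0 x => d0.
apply/eqP; rewrite eq_complex /=; apply/andP; split; apply/eqP;
  by rewrite /res_den in d0 *; field; rewrite gt_eqF.
Qed.

Lemma normc_resolvent_symbol2 x : normc (resolvent_symbol x) ^+ 2 = (res_den x)^-1.
Proof.
have d0 := res_den_gt0 x.
rewrite /= sqr_sqrtr ?addr_ge0 ?sqr_ge0// sqrrN !expr_div_n -mulrDl.
by rewrite -/(res_den x) expr2 invfM mulrA mulfV ?mul1r// gt_eqF.
Qed.

Lemma normc_resolvent_symbol n x : n.+1%:R <= `|w| ->
  normc (resolvent_symbol x) <= 2 * (n.+1%:R + x ^+ 2)^-1.
Proof.
move=> nw; have n0 : 0 < n.+1%:R + x ^+ 2 by rewrite ltr_pwDl// sqr_ge0.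
rewrite -[leLHS](ger0_norm (normc_ge0 _)).
rewrite -[leRHS]ger0_norm ?mulr_ge0 ?invr_ge0 ?(ltW n0)// -!sqrtr_sqr ler_wsqrtr//.
rewrite normc_resolvent_symbol2 exprMn exprVn -[leLHS]mul1r.
rewrite ler_pdivrMr ?res_den_gt0// mulrAC ler_pdivlMr ?exprn_gt0// mul1r.
rewrite /res_den -(real_normK (num_real w)).
by apply: sum_sqr_le; rewrite ?sqr_ge0.
Qed.

(** The solution phi of (i w + x^2 + eta) phi(x) = p(x) b, the third line of the
    eigenvalue equation of the augmented operator when [b] is the value of the
    observation. *)
Definition profile (b : U) (x : R) : U :=
  (weight alpha x)%:C *: (resolvent_symbol x *: b).

Lemma strongly_measurable_cst (b : U) :
  strongly_measurable mu (cst b : measurableTypeR R -> U).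
Proof.
exists (fun n =>
  [:: (`[- n%:R, n%:R]%classic : set (measurableTypeR R), b)]); split.
  move=> n p; rewrite inE => /eqP -> /=; split; first exact: measurable_itv.
  by rewrite lebesgue_measure_itv/=; case: ifP => // _; rewrite -EFinB ltry.
move=> x; apply: cvg_near_cst; near=> n.
rewrite /simple_fun big_seq1 /= indicE mem_set ?scale1r//= in_itv/=.
rewrite -ler_norml; near: n; exact: nbhs_infty_ger.
Unshelve. all: by end_near. Qed.

Lemma measurable_symbol_num : measurable_fun [set: R] (fun x : R => x ^+ 2 + eta).
Proof. by apply: measurable_funD => //; exact: exprn_measurable. Qed.

Lemma measurable_res_den : measurable_fun [set: R] (fun x => (res_den x)^-1).
Proof.
apply: measurable_inv_ge0 => [|x]; last exact: ltW (res_den_gt0 x).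
apply: measurable_funD => //; apply: measurable_funX; exact: measurable_symbol_num.
Qed.

Lemma weight_ge0 (x : R) : 0 <= weight alpha x.
Proof. exact: powR_ge0. Qed.

Lemma strongly_measurable_profile b : strongly_measurable mu (profile b).
Proof.
have id0 x : 0 <= (res_den x)^-1 by rewrite invr_ge0 ltW// res_den_gt0.
have s0 x : 0 <= x ^+ 2 + eta by rewrite addr_ge0// sqr_ge0.
pose g1 x := weight alpha x * (res_den x)^-1.
pose g2 x := (x ^+ 2 + eta) * g1 x.
have mg1 : measurable_fun [set: R] g1.
  by apply: measurable_funM; [exact: measurable_weight|exact: measurable_res_den].
have mg2 : measurable_fun [set: R] g2.
  by apply: measurable_funM => //; exact: measurable_symbol_num.
have h1 : strongly_measurable mu (fun x => (g1 x)%:C *: cst b x).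
  apply: strongly_measurable_scaleR => //; last exact: strongly_measurable_cst.
  by move=> x; rewrite mulr_ge0 ?weight_ge0.
have h2 : strongly_measurable mu (fun x => (g2 x)%:C *: cst b x).
  apply: strongly_measurable_scaleR => //; last exact: strongly_measurable_cst.
  by move=> x; rewrite !mulr_ge0 ?weight_ge0.
rewrite (_ : profile b = (0 +i* (- w)) *: (fun x => (g1 x)%:C *: cst b x) +
    (fun x => (g2 x)%:C *: cst b x)); first exact: strongly_measurable_lin.
apply/funext => x; rewrite !fctE /profile !scalerA -scalerDl; congr (_ *: _).
apply/eqP; rewrite eq_complex /= /g2 /g1; apply/andP; split; apply/eqP; ring.
Qed.

Lemma strongly_measurable_norm_mul (f : R -> U) : strongly_measurable mu f ->
  strongly_measurable mu (fun x : R => `|x|%:C *: f x).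
Proof.
by move=> mf; apply: strongly_measurable_scaleR => //; exact: normr_measurable.
Qed.

Let bound : R := 1 + (w ^+ 2)^-1.

(** The first and second bounds give the square integrability of the profile, the
    second and third ones that of its product with |x|. *)
Lemma res_den_bounds x : [/\ (res_den x)^-1 <= bound,
  (res_den x)^-1 * x ^+ 2 <= bound & (res_den x)^-1 * x ^+ 2 * x ^+ 2 <= bound].
Proof.
have w2 : 0 < w ^+ 2 by rewrite exprn_even_gt0.
have x2 := sqr_ge0 x; have d0 := res_den_gt0 x.
have h1 : (res_den x)^-1 <= (w ^+ 2)^-1.
  by rewrite lef_pV2 ?posrE// /res_den lerDr sqr_ge0.
have h2 : (res_den x)^-1 * x ^+ 2 * x ^+ 2 <= 1.
  rewrite -mulrA mulrC ler_pdivrMr// mul1r /res_den.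
  apply: (@le_trans _ _ ((x ^+ 2 + eta) ^+ 2)); last by rewrite lerDl ltW.
  by rewrite -expr2 ler_pXn2r ?nnegrE ?addr_ge0 ?lerDl.
have i0 : 0 < (res_den x)^-1 by rewrite invr_gt0.
have j0 : 0 < (w ^+ 2)^-1 by rewrite invr_gt0.
have b1 : 1 <= bound by rewrite lerDl ltW.
have b2 : (w ^+ 2)^-1 <= bound by rewrite lerDr.
split; [exact: le_trans b2| |exact: le_trans b1].
have [x1|x1] := leP (x ^+ 2) 1.
  apply: (@le_trans _ _ (res_den x)^-1); last exact: le_trans b2.
  by rewrite ler_piMr// ltW.
apply: (@le_trans _ _ ((res_den x)^-1 * x ^+ 2 * x ^+ 2)); last exact: le_trans b1.
by rewrite ler_peMr ?(ltW x1)// mulr_ge0// ltW.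
Qed.

Lemma rnorm_profile2 b x : rnorm (profile b x) ^+ 2 =
  weight alpha x ^+ 2 * (res_den x)^-1 * rnorm b ^+ 2.
Proof.
rewrite /profile !rnormZc normcR ger0_norm ?weight_ge0//.
by rewrite !exprMn normc_resolvent_symbol2 mulrA.
Qed.

Lemma profile_L2fun b : profile b \in L2fun mu.
Proof.
apply/L2funP; split; first exact: strongly_measurable_profile.
under eq_integral do rewrite rnorm_profile2 EFinM.
have iw : mu.-integrable [set: R]
    (fun x => (weight alpha x ^+ 2 * (res_den x)^-1)%:E).
  apply: (@weight_integrable _ _ bound) => //; first exact: measurable_res_den.
  - by move=> x; rewrite invr_ge0 ltW// res_den_gt0.
  - by move=> x; have [] := res_den_bounds x.
  - by move=> x; have [] := res_den_bounds x.
rewrite integralZr//.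
have /integrable_fin_num := iw => /(_ measurableT) h.
by rewrite -[X in (X * _)%E]fineK// -EFinM ltry.
Qed.

Lemma norm_mul_profile_L2fun b :
  (fun x : R => `|x|%:C *: profile b x) \in L2fun mu.
Proof.
apply/L2funP; split.
  exact/strongly_measurable_norm_mul/strongly_measurable_profile.
have e x : rnorm (`|x|%:C *: profile b x) ^+ 2 =
    weight alpha x ^+ 2 * ((res_den x)^-1 * x ^+ 2) * rnorm b ^+ 2.
  rewrite rnormZc normcR normr_id exprMn real_normK ?num_real// rnorm_profile2.
  by ring.
under eq_integral do rewrite e EFinM.
have iw : mu.-integrable [set: R]
    (fun x => (weight alpha x ^+ 2 * ((res_den x)^-1 * x ^+ 2))%:E).
  apply: (@weight_integrable _ _ bound) => //.
  - by apply: measurable_funM; [exact: measurable_res_den|exact: exprn_measurable].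
  - by move=> x; rewrite mulr_ge0 ?sqr_ge0// invr_ge0 ltW// res_den_gt0.
  - by move=> x; have [] := res_den_bounds x.
  - by move=> x; have [] := res_den_bounds x.
rewrite integralZr//.
have /integrable_fin_num := iw => /(_ measurableT) h.
by rewrite -[X in (X * _)%E]fineK// -EFinM ltry.
Qed.

End Profile.

(** * The weighted integral of a profile *)

Section WeightedIntegral.
Context {R : realType} {U : hilbertType R}.
Variables (alpha eta w : R).
Hypotheses (alpha_gt0 : 0 < alpha) (alpha_lt1 : alpha < 1) (eta_ge0 : 0 <= eta)
  (w_neq0 : w != 0).
Let mu : {measure set (measurableTypeR R) -> \bar R} := @lebesgue_measure R.
Variables (b : U) (phi : diffusive_space U).
Hypothesis phiE : {ae mu, forall x, repr phi x = profile alpha eta w b x}.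

Let wint := weighted_integral alpha phi.
Let k := resolvent_symbol eta w.

(** Where no Bochner integral exists the weighted integral is 0 by convention, and
    each property established below also holds for 0. *)
Lemma weighted_integral_bochner :
  is_bochner mu
    (fun x : measurableTypeR R => (weight alpha x)%:C *: repr phi x) wint \/
  wint = 0.
Proof.
rewrite /wint /weighted_integral /bochner_integral.
by case: xgetP => [y _ //|]; [left|right].
Qed.

Lemma measurable_symbol_dot (d : R[i]) :
  measurable_fun [set: R] (fun x => weight alpha x ^+ 2 * complex.Re (k x * d)).
Proof.
apply: measurable_funM.
  by apply: measurable_funX; exact: measurable_weight.
have mr := measurable_res_den eta w_neq0.
case: d => p q /=; apply: measurable_funB; apply: measurable_funM => //.
  by apply: measurable_funM => //; exact: measurable_symbol_num.
by apply: measurableT_comp => //; apply: measurable_funM.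
Qed.

(** By [bochner_Re_dot], Re <int p phi, z> is the integral of
    Re <p phi, z> = p^2 Re (k <b, z>), where k is the resolvent symbol. *)
Lemma Re_dot_weighted_integral z :
  is_bochner mu
    (fun x : measurableTypeR R => (weight alpha x)%:C *: repr phi x) wint ->
  mu.-integrable [set: R]
    (fun x => (weight alpha x ^+ 2 * complex.Re (k x * dot b z))%:E) /\
  complex.Re (dot wint z) = Rintegral mu [set: R]
    (fun x => weight alpha x ^+ 2 * complex.Re (k x * dot b z)).
Proof.
move=> /(bochner_Re_dot z)[ib ->].
have e : {ae mu, forall x : measurableTypeR R, setT x ->
    (complex.Re (dot ((weight alpha x)%:C *: repr phi x) z))%:E =
    (weight alpha x ^+ 2 * complex.Re (k x * dot b z))%:E}.
  apply: filterS phiE => x -> _; rewrite /profile -/k !dotZl; congr EFin.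
  case: (k x) (dot b z) => p q [r s] /=; ring.
have /integrableP[mb fb] := ib.
have mk : measurable_fun [set: R]
    (fun x => (weight alpha x ^+ 2 * complex.Re (k x * dot b z))%:E).
  by apply/measurable_EFinP; exact: measurable_symbol_dot.
split; last by congr fine; exact: ae_eq_integral.
apply/integrableP; split => //; move: fb; congr (_ < +oo)%E.
apply: ae_eq_integral => //; [exact: measurableT_comp|exact: measurableT_comp|].
by apply: filterS e => x h xT; rewrite h.
Qed.

Lemma weighted_integral0 : b = 0 -> wint = 0.
Proof.
move=> b0; have [h|//] := weighted_integral_bochner.
have [_ e] := Re_dot_weighted_integral wint h.
apply: rnorm_eq0; apply/eqP; rewrite -sqrf_eq0 -Re_dotxx e b0.
under eq_Rintegral do rewrite dot0l mulr0 /= mulr0.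
by rewrite /Rintegral integral0.
Qed.

(** The component of the integral orthogonal to [b] vanishes, since all values of
    the integrand are multiples of [b]. *)
Lemma weighted_integral_colinear : exists c : R[i], wint = c *: b.
Proof.
have [h|->] := weighted_integral_bochner; last by exists 0; rewrite scale0r.
have [b0|b0] := eqVneq b 0.
  by exists 0; rewrite scale0r weighted_integral0.
have nb : dot b b != 0.
  rewrite dotxxE; apply/eqP => -[/eqP]; rewrite sqrf_eq0 => /eqP/rnorm_eq0/eqP.
  by rewrite (negbTE b0).
pose c := dot wint b / dot b b; exists c.
pose z := wint - c *: b.
have zb : dot z b = 0 by rewrite /z dotDl dotNl dotZl /c divfK// subrr.
have bz : dot b z = 0 by rewrite dotC zb rmorph0.
have [_ e] := Re_dot_weighted_integral z h.
have e0 : complex.Re (dot wint z) = 0.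
  rewrite e; under eq_Rintegral do rewrite bz mulr0 /= mulr0.
  by rewrite /Rintegral integral0.
apply/eqP; rewrite -subr_eq0 -/z; apply/eqP/rnorm_eq0/eqP.
rewrite -sqrf_eq0 -Re_dotxx {1}/z dotDl dotNl dotZl bz mulr0 subr0.
by rewrite e0.
Qed.

Lemma weighted_integral_bound : exists2 c : R[i], wint = c *: b &
  forall n, n.+1%:R <= `|w| -> normc c <= 2 * decay alpha n.
Proof.
have decay_ge0 n : 0 <= decay alpha n.
  apply: Rintegral_ge0 => x _; rewrite mulr_ge0 ?sqr_ge0//.
  by have [] := decay_kernel n x.
have [b0|b0] := eqVneq b 0.
  exists 0; first by rewrite scale0r weighted_integral0.
  by move=> n _; rewrite normc0 mulr_ge0.
have [c ce] := weighted_integral_colinear; exists c => // n nw.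
have [h|w0] := weighted_integral_bochner; last first.
  have [->|c0] := eqVneq c 0; first by rewrite normc0 mulr_ge0.
  move: ce; rewrite w0 => /esym/eqP; rewrite scaler_eq0 (negbTE c0) (negbTE b0).
  by [].
have [ik e] := Re_dot_weighted_integral wint h.
have rb : 0 < rnorm b ^+ 2.
  rewrite exprn_gt0// lt0r rnorm_ge0 andbT; apply: contra b0 => /eqP h0.
  exact/eqP/rnorm_eq0.
have bw : normc (dot b wint) = normc c * rnorm b ^+ 2.
  rewrite ce dotZr normcM dotxxE normcR ger0_norm ?sqr_ge0//; congr (_ * _).
  by case: (c) => p q /=; rewrite sqrrN.
have := e; rewrite Re_dotxx {1}ce rnormZc exprMn => e'.
have : normc c ^+ 2 * rnorm b ^+ 2 <=
    2 * decay alpha n * (normc c * rnorm b ^+ 2).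
  rewrite e' -bw.
  rewrite (_ : 2 * _ * _ = decay alpha n * (2 * normc (dot b wint))); last by ring.
  have idec := decay_integrable n alpha_gt0 alpha_lt1.
  rewrite /decay -RintegralZr//; apply: le_Rintegral => //.
    exact: (integrableZr measurableT _ idec).
  move=> x _; rewrite -mulrA ler_wpM2l ?sqr_ge0//.
  apply: (le_trans (ler_norm _)); apply: (le_trans (Re_le_normc _)).
  rewrite normcM [_ * (2 * _)]mulrCA mulrA ler_wpM2r ?normc_ge0//.
  exact: normc_resolvent_symbol.
rewrite (mulrA (2 * _)) (ler_pM2r rb) expr2.
have [->|c0] := eqVneq (normc c) 0; first by rewrite mulr_ge0.
by rewrite ler_pM2r// lt0r c0 normc_ge0.
Qed.

(** Re <int p phi, b> is the integral of p^2 (x^2 + eta) / |i w + x^2 + eta|^2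
    times |b|^2, which is positive unless [b] vanishes: a vibration that is
    observed loses energy. *)
Lemma weighted_integral_coercive : complex.Re (dot wint b) = 0 -> wint = 0.
Proof.
move=> w0; have [h|//] := weighted_integral_bochner.
have [ik e] := Re_dot_weighted_integral b h.
have [/weighted_integral0//|b0] := eqVneq b 0; exfalso.
have rb : 0 < rnorm b ^+ 2.
  rewrite exprn_gt0// lt0r rnorm_ge0 andbT; apply: contra b0 => /eqP h0.
  exact/eqP/rnorm_eq0.
have gE x : weight alpha x ^+ 2 * complex.Re (k x * dot b b) =
    weight alpha x ^+ 2 * ((x ^+ 2 + eta) / res_den eta w x * rnorm b ^+ 2).
  by rewrite dotxxE /= mulr0 subr0.
have d0 x := res_den_gt0 eta w_neq0 x.
have g0 x : 0 <= weight alpha x ^+ 2 * complex.Re (k x * dot b b).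
  rewrite gE mulr_ge0 ?sqr_ge0// mulr_ge0 ?sqr_ge0//.
  by rewrite divr_ge0 ?(ltW (d0 x))// addr_ge0 ?sqr_ge0.
have /integrableP[mg _] := ik.
have int0 : (\int[mu]_x
    `|(weight alpha x ^+ 2 * complex.Re (k x * dot b b))%:E|)%E = 0%E.
  under eq_integral do rewrite gee0_abs ?lee_fin//.
  have /integrable_fin_num := ik => /(_ measurableT) fk.
  by rewrite -[LHS]fineK// -[fine _]/(Rintegral _ _ _) -e w0.
have := (ae_eq_integral_abs mu measurableT mg).1 int0 => ae0.
have : {ae mu, forall x : measurableTypeR R, False}.
  apply: filterS2 ae0 (@ae_neq0 R) => x /(_ I)[]; rewrite gE => gx x0.
  have x2 : 0 < x ^+ 2 by rewrite exprn_even_gt0.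
  have wx : 0 < weight alpha x ^+ 2 by rewrite exprn_gt0// powR_gt0// normr_gt0.
  have sx : 0 < (x ^+ 2 + eta) / res_den eta w x by rewrite divr_gt0// ltr_wpDr.
  by have := mulr_gt0 wx (mulr_gt0 sx rb); rewrite gx ltxx.
move=> [N [mN N0 subN]].
have : (mu `[0%R, 1%R]%classic <= mu N)%E.
  have m01 : measurable (`[0%R, 1%R]%classic : set (measurableTypeR R)).
    exact: measurable_itv.
  by apply: le_measure; rewrite ?inE// => x _; apply: subN => /=.
rewrite N0 -[mu _]/(lebesgue_measure _) lebesgue_measure_itv/=.
by rewrite lte_fin ltr01 -EFinB subr0 lee_fin leNgt ltr01.
Qed.

End WeightedIntegral.

(** * Quasimodes and eigenvectors of the augmented operator *)

Section AugmentedModes.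
Context {R : realType} {H U : hilbertType R}.
Variables (A S : linear_op H H).
Hypothesis S_sqrt : is_sqrt_op A S.
Variables (B : {linear U -> dual_half_space S}) (Bs : half_space S -> U).
Hypothesis Bs_adjoint : is_adjoint B Bs.
Variables alpha eta : R.
Hypotheses (alpha_gt0 : 0 < alpha) (alpha_lt1 : alpha < 1) (eta_ge0 : 0 <= eta).
Let mu : {measure set (measurableTypeR R) -> \bar R} := @lebesgue_measure R.
Let Aug := augmented_op B Bs alpha eta.

Lemma strongly_measurable_diffusive (v : H) (phi : diffusive_space U) :
  strongly_measurable mu (diffusive_part Bs alpha eta v phi).
Proof.
have h1 : strongly_measurable mu
    (fun x : R => (weight alpha x)%:C *: cst (Bs (to_half S v)) x).
  apply: strongly_measurable_scaleR; last exact: strongly_measurable_cst.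
    exact: measurable_weight.
  by move=> x; exact: weight_ge0.
have h2 : strongly_measurable mu
    (fun x : R => (`|x| ^+ 2 + eta)%:C *: repr phi x).
  apply: strongly_measurable_scaleR; last exact: strongly_measurable_repr.
    apply: measurable_funD => //; apply: measurable_funX; exact: normr_measurable.
  by move=> x; rewrite addr_ge0// sqr_ge0.
rewrite (_ : diffusive_part _ _ _ _ _ =
  (-1 : R[i]) *: (fun x : R => (`|x| ^+ 2 + eta)%:C *: repr phi x) +
  (fun x : R => (weight alpha x)%:C *: cst (Bs (to_half S v)) x)).
  exact: strongly_measurable_lin.
by apply/funext => x; rewrite !fctE /diffusive_part scaleN1r scaleNr.
Qed.

Lemma L2fun_ae_eq (f g : R -> U) : strongly_measurable mu f ->
  {ae mu, forall x : measurableTypeR R, f x = g x} ->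
  g \in L2fun mu -> f \in L2fun mu.
Proof.
move=> mf fg /L2funP[mg ig]; apply/L2funP; split => //.
move: ig; congr (_ < +oo)%E; apply: ae_eq_integral => //.
- by apply/measurable_EFinP; exact: measurable_rnorm2 mg.
- by apply/measurable_EFinP; exact: measurable_rnorm2 mf.
by apply: filterS fg => x fgx _ /=; rewrite fgx.
Qed.

Section Mode.
Variables (w : R) (u : half_space S) (h : H).
Hypothesis w_neq0 : w != 0.
Hypotheses (Au : pdom A (half_val u))
  (AuE : A (half_val u) = (w ^+ 2)%:C *: half_val u).
Hypothesis BBu : represents h (B (Bs u)).

(** The wave mode completed by the diffusive component that solves the third line
    of the eigenvalue equation exactly. *)
Definition aug_mode : energy_space U S :=
  (wave_mode w u, L2class mu (profile alpha eta w (Bs u))).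

(** The first and third lines of the eigenvalue equation hold exactly.  The
    second one fails by gamma B int p phi, where int p phi = c B^* u with c small
    for high frequencies; the defect is then gamma c B B^* u. *)
Lemma aug_mode_defect : exists2 c : R[i],
  pdom Aug aug_mode /\
  (0 +i* w) *: aug_mode - Aug aug_mode = ((0, (gamma alpha)%:C * c *: h), 0) &
  forall n, n.+1%:R <= `|w| -> normc c <= 2 * decay alpha n.
Proof.
have phiL := profile_L2fun alpha_gt0 alpha_lt1 eta_ge0 w_neq0 (Bs u).
have phiE := L2class_ae phiL.
set phi := L2class _ _ in phiE.
have [c ce cn] :=
  weighted_integral_bound alpha_gt0 alpha_lt1 eta_ge0 w_neq0 phiE.
exists c => //.
have i0 : (0 +i* w : R[i]) != 0 by rewrite eq_complex /= negb_and w_neq0 orbT.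
pose u' := (0 +i* w)^-1 *: u.
have form : represents (A (half_val u') + (gamma alpha)%:C * c *: h)
    (aug_form B alpha u' phi).
  move=> z.
  have -> : aug_form B alpha u' phi z = half_dot u' z +
      (gamma alpha)%:C * B (weighted_integral alpha phi) z by [].
  have Au' : pdom A (half_val u') by exact: dom_scale.
  rewrite dotDl /half_dot (weak_op S_sqrt)//; congr (_ + _).
  by rewrite Bs_adjoint ce !dotZl -Bs_adjoint BBu mulrA.
have diffE : {ae mu, forall x : measurableTypeR R,
    diffusive_part Bs alpha eta (half_val u) phi x =
    (repr ((0 +i* w) *: phi) : measurableTypeR R -> U) x}.
  apply: filterS2 phiE (repr_scale (0 +i* w) phi) => x e1 ->.
  rewrite /diffusive_part e1 to_half_val /profile !scalerA -scalerDl.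
  congr (_ *: _); rewrite real_normK ?num_real//.
  have := resolvent_symbolM eta w_neq0 x.
  have -> : (x ^+ 2 + eta) +i* w = (x ^+ 2 + eta)%:C + 0 +i* w.
    by apply/eqP; rewrite eq_complex /= addr0 add0r !eqxx.
  set k := resolvent_symbol _ _ _; set s := (_ + _)%:C; set l := 0 +i* w.
  set p := (weight _ _)%:C => e.
  by rewrite -[X in _ + X]mulr1 -e; ring.
have diffL : diffusive_part Bs alpha eta (half_val u) phi \in L2fun mu.
  apply: (L2fun_ae_eq (strongly_measurable_diffusive _ _) diffE).
  exact: repr_L2fun.
split.
  split; first exact: half_dom.
  - by eexists; exact: form.
  - apply: (L2fun_ae_eq (g := fun x => `|x|%:C *: profile alpha eta w (Bs u) x)).
    + apply: strongly_measurable_norm_mul; exact: strongly_measurable_repr.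
    + by apply: filterS phiE => x ->.
    exact: norm_mul_profile_L2fun.
  - exact: diffL.
have e1 : to_half S (half_val u) = (0 +i* w) *: u'.
  by rewrite to_half_val /u' scalerA mulfV// scale1r.
have e2 : A (half_val u') = - ((0 +i* w) *: half_val u).
  rewrite [half_val u'](_ : _ = (0 +i* w)^-1 *: half_val u)// linear_opZ// AuE.
  rewrite scalerA -scaleNr; congr (_ *: _); apply: (mulfI i0).
  rewrite mulrA mulfV// mul1r.
  by apply/eqP; rewrite eq_complex /=; apply/andP; split; apply/eqP; ring.
have e3 := L2classK diffL diffE.
rewrite /Aug /aug_mode /wave_mode /= -/u' -/phi e1 e3 (pivot_reprE S_sqrt form) e2.
congr (_, _, _); first by rewrite subrr.
  by rewrite /= opprK addrA subrr add0r.
by rewrite subrr.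
Qed.

Lemma aug_mode_norm_ge1 : wave_dot (wave_mode w u) (wave_mode w u) = 1 ->
  1 <= energy_norm alpha aug_mode.
Proof.
rewrite /wave_dot /half_dot !dotxxE => /(congr1 (fun a : R[i] => complex.Re a)) /= e.
rewrite energy_normE -sqrtr1 ler_wsqrtr// /energy_sq /= -e.
by rewrite lerDl mulr_ge0 ?L2sq_ge0//; exact: gamma_ge0.
Qed.

End Mode.

Lemma energy_norm_pivot (y : H) :
  energy_norm alpha (((0, y), 0) : energy_space U S) = rnorm y.
Proof.
rewrite energy_normE /energy_sq /= half_op0 rnorm0 expr0n /= add0r.
have -> : L2sq mu (repr (0 : diffusive_space U)) = 0.
  by rewrite -[0 in LHS](scale0r 0) L2sqZ normc0 expr0n mul0r.
by rewrite mulr0 addr0 sqrtr_sqr ger0_norm ?rnorm_ge0.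
Qed.

(** An eigenvector for i w is a free vibration of the undamped wave equation:
    testing the second line against [u] and taking imaginary parts leaves
    gamma Re <int p phi, b> = 0, so the damping term vanishes by
    [weighted_integral_coercive]. *)
Lemma aug_eigenvector (w : R) (X : energy_space U S) : w != 0 ->
  pdom Aug X -> Aug X = (0 +i* w) *: X ->
  [/\ pdom A (half_val X.1.1), A (half_val X.1.1) = (w ^+ 2)%:C *: half_val X.1.1,
      X.1.2 = (0 +i* w) *: half_val X.1.1 &
      {ae mu, forall x : measurableTypeR R, (repr X.2 : measurableTypeR R -> U) x =
        profile alpha eta w (Bs (to_half S X.1.2)) x}].
Proof.
case: X => -[u v] phi w0 /= [Sv [h hF] xL dL] [] e1 e2 e3.
have vE : v = (0 +i* w) *: half_val u by rewrite -(to_halfE Sv) e1.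
set b := Bs (to_half S v).
have bE : b = (0 +i* w) *: Bs u by rewrite /b e1 (adjointZ Bs_adjoint).
have phiE : {ae mu, forall x : measurableTypeR R,
    repr phi x = profile alpha eta w b x}.
  have := L2class_ae dL; rewrite e3 => d1.
  apply: filterS2 d1 (repr_scale (0 +i* w) phi) => x h1 h2.
  rewrite {}h1 in h2; move: h2.
  rewrite /diffusive_part real_normK ?num_real// -/b => h2.
  have h3 : ((x ^+ 2 + eta) +i* w) *: repr phi x = (weight alpha x)%:C *: b.
    have -> : (x ^+ 2 + eta) +i* w = (x ^+ 2 + eta)%:C + 0 +i* w.
      by apply/eqP; rewrite eq_complex /= addr0 add0r !eqxx.
    by rewrite scalerDl -h2 scaleNr addrA subrr add0r.
  rewrite /profile scalerA mulrC -scalerA -h3 scalerA mulrC.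
  by rewrite resolvent_symbolM// scale1r.
have hE : h = (w ^+ 2)%:C *: half_val u.
  have := e2; rewrite (pivot_reprE S_sqrt hF) vE => /(congr1 -%R); rewrite opprK => ->.
  rewrite scalerA -scaleNr; congr (_ *: _).
  by apply/eqP; rewrite eq_complex /=; apply/andP; split; apply/eqP; ring.
set wi := weighted_integral alpha phi.
(* The second line of the eigenvalue equation in weak form. *)
have formE (z : half_space S) : half_dot u z + (gamma alpha)%:C * dot wi (Bs z) =
    dot h (half_val z).
  by rewrite -hF -Bs_adjoint.
have g0 : gamma alpha = 0 \/ wi = 0.
  have [->|gn] := eqVneq (gamma alpha) 0; first by left.
  right; apply: (weighted_integral_coercive eta_ge0 w0 phiE).
  have := formE u; rewrite /half_dot hE dotZl !dotxxE -/b bE dotZr.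
  case: (dot wi (Bs u)) => p q /(congr1 (fun a : R[i] => complex.Im a)) /=.
  rewrite !mul0r !mulr0 !addr0 !add0r => /eqP.
  rewrite mulf_eq0 (negbTE gn) /= => /eqP ->.
  by rewrite mulr0 oppr0 ?subr0 ?addr0.
have wz z : (gamma alpha)%:C * dot wi (Bs z) = 0.
  by case: g0 => ->; rewrite ?mul0r// dot0l mulr0.
have weak z : half_dot u z = dot h (half_val z) by rewrite -formE wz addr0.
have [Au AuE] := weak_op_dom S_sqrt weak.
by split => //; rewrite AuE.
Qed.

End AugmentedModes.

(** * The orthonormal basis of wave modes *)

Section WaveBasis.
Context {R : realType} {H : hilbertType R}.
Variables A S : linear_op H H.
Hypothesis S_sqrt : is_sqrt_op A S.

Lemma wave_dot_lin a (X Y Z : half_space S * H) :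
  wave_dot (a *: X + Y) Z = a * wave_dot X Z + wave_dot Y Z.
Proof.
rewrite /wave_dot /half_dot /= half_op_lin !dotDl !dotZl; ring.
Qed.

Lemma wave_dotC (X Y : half_space S * H) : wave_dot X Y = (wave_dot Y X)^*.
Proof. by rewrite /wave_dot rmorphD /= /half_dot -!dotC. Qed.

Lemma wave_dot_sumr (X : half_space S * H) N (c : nat -> R[i])
    (e : nat -> half_space S * H) :
  (forall k, wave_dot X (e k) = 0) ->
  wave_dot X (\sum_(0 <= k < N) c k *: e k) = 0.
Proof.
move=> Xe; elim: N => [|N ih].
  rewrite big_nil wave_dotC.
  have := wave_dot_lin (-1) 0 0 X; rewrite scaler0 addr0 mulN1r addNr => ->.
  exact: rmorph0.
rewrite big_nat_recr //= wave_dotC addrC wave_dot_lin.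
rewrite [wave_dot (e N) X]wave_dotC Xe.
rewrite [wave_dot (\sum_(_ <= _ < _) _) X]wave_dotC ih.
by rewrite !rmorph0 mulr0 addr0 rmorph0.
Qed.

Lemma Re_wave_dotxx (X : half_space S * H) :
  complex.Re (wave_dot X X) = rnorm (S (half_val X.1)) ^+ 2 + rnorm X.2 ^+ 2.
Proof. by rewrite /wave_dot /half_dot !dotxxE. Qed.

Lemma orthogonal_basis_eq0 (e : nat -> half_space S * H) (X : half_space S * H) :
  orthonormal_basis e -> (forall k, wave_dot X (e k) = 0) ->
  rnorm (S (half_val X.1)) ^+ 2 + rnorm X.2 ^+ 2 = 0.
Proof.
move=> [_ dense_e] Xe; apply/eqP; rewrite eq_le addr_ge0 ?sqr_ge0// andbT.
apply/ler_addgt0Pr => eps eps0; rewrite add0r.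
have s0 : 0 < Num.sqrt eps by rewrite sqrtr_gt0.
have [N [c]] := dense_e X _ s0; set Y := \sum_(_ <= _ < _) _ => hY.
have XY : wave_dot X Y = 0 by exact: wave_dot_sumr.
have YX : wave_dot Y X = 0 by rewrite wave_dotC XY rmorph0.
have e1 : wave_dot (X - Y) (X - Y) = wave_dot X X + wave_dot Y Y.
  have lin Z : wave_dot (X - Y) Z = wave_dot X Z - wave_dot Y Z.
    by rewrite -scaleN1r addrC wave_dot_lin mulN1r addrC.
  rewrite lin [wave_dot X (X - Y)]wave_dotC [wave_dot Y (X - Y)]wave_dotC !lin XY YX.
  by rewrite subr0 sub0r rmorphN/= opprK -!wave_dotC.
rewrite -Re_wave_dotxx ltW//.
apply: (@le_lt_trans _ _ (complex.Re (wave_dot (X - Y) (X - Y)))).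
  by rewrite e1 [leRHS]raddfD/= lerDl Re_wave_dotxx addr_ge0 ?sqr_ge0.
move: hY; rewrite /wave_norm ltr_sqrt//.
Qed.

(** Eigenvectors of a self-adjoint operator for distinct eigenvalues are
    orthogonal. *)
Lemma wave_dot_eigen_neq (w w' : R) (u z : half_space S) : `|w| < `|w'| ->
  pdom A (half_val u) -> A (half_val u) = (w ^+ 2)%:C *: half_val u ->
  pdom A (half_val z) -> A (half_val z) = (w' ^+ 2)%:C *: half_val z ->
  wave_dot (u, (0 +i* w) *: half_val u) (wave_mode w' z) = 0.
Proof.
move=> ww' Au AuE Az AzE.
have d0 : dot (half_val u) (half_val z) = 0.
  have e1 := weak_op S_sqrt z Au; have e2 := weak_op S_sqrt u Az.
  move: e2; rewrite dotC e1 AuE AzE !dotZl [dot (half_val z) _]dotC.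
  have cjM (x : R) (a : R[i]) : (x%:C * a)^* = x%:C * a^*.
    by rewrite (rmorphM (@conjc R)); congr (_ * _); exact: conjc_real.
  rewrite cjM => /eqP.
  rewrite -subr_eq0 -mulrBl mulf_eq0 conjc_eq0 => /orP[|/eqP//].
  rewrite subr_eq0 => /eqP /(congr1 (fun a : R[i] => complex.Re a)) ww.
  have {}ww : `|w| ^+ 2 = `|w'| ^+ 2 by rewrite !real_normK ?num_real.
  by move: ww'; rewrite -(@ltr_pXn2r _ 2) ?nnegrE// ww ltxx.
rewrite /wave_dot /wave_mode /half_dot /= half_opZ dotZr (weak_op S_sqrt)// AuE !dotZl.
by rewrite d0 !mulr0 addr0.
Qed.

End WaveBasis.

(** * Stability of the semigroup *)

Section Stability.
Context {R : realType} {H U : hilbertType R}.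
Variables (A S : linear_op H H).
Hypothesis S_sqrt : is_sqrt_op A S.
Variables (B : {linear U -> dual_half_space S}) (Bs : half_space S -> U).
Hypothesis Bs_adjoint : is_adjoint B Bs.
Variables alpha eta : R.
Hypotheses (alpha_gt0 : 0 < alpha) (alpha_lt1 : alpha < 1) (eta_ge0 : 0 <= eta).
Variable etA : R -> {linear energy_space U S -> energy_space U S}.
Hypothesis sgT : C0_semigroup (energy_norm alpha) etA.
Hypothesis genT : generated_by (energy_norm alpha) etA (augmented_op B Bs alpha eta).
Variables (omega : nat -> R) (u : nat -> half_space S).
Hypothesis omega_infty : `|omega n| @[n --> \oo] --> +oo.
Hypothesis u_eigen : forall n, is_eigenvector (wave_op A S) (0 +i* omega n)
  (wave_mode (omega n) (u n)).
Hypothesis u_basis : orthonormal_basis (fun n => wave_mode (omega n) (u n)).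

Let N : energy_space U S -> R := energy_norm alpha.
Let snN : seminorm N := seminorm_energy S alpha_gt0 alpha_lt1.
Let mu : {measure set (measurableTypeR R) -> \bar R} := @lebesgue_measure R.

Lemma omega_large (r : R) : exists n0, forall n, (n0 <= n)%N -> r <= `|omega n|.
Proof.
have [n0 _ h] : \forall n \near \oo, r <= `|omega n|.
  by move/cvgryPge : omega_infty; exact.
by exists n0.
Qed.

(** The quasimodes have norm at least 1, while their defects are bounded by
    2 gamma C times [decay], which tends to 0 along the frequencies; this
    contradicts a resolvent bounded on the imaginary axis. *)
Lemma not_exponentially_stable_of_bounded (k : nat -> nat) (C : R) :
  {homo k : m n / (m < n)%N} ->
  (forall n, exists2 h : H, represents h (B (Bs (u (k n)))) & rnorm h <= C) ->
  ~ exponentially_stable N etA.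
Proof.
move=> kmono hk /(exponentially_stable_resolvent snN sgT genT)[M M0 res].
have kn n : (n <= k n)%N.
  by elim: n => // n ih; apply: leq_ltn_trans ih _; exact: kmono.
have g0 := gamma_ge0 alpha_gt0 alpha_lt1.
pose K := M * (gamma alpha * 2 * `|C|).
have step m : 1 <= K * decay alpha m.
  have [n0 hn0] := omega_large m.+1%:R.
  have mw := hn0 _ (kn n0); have [h hh hC] := hk n0.
  have [w0 Au AuE] := wave_eigenvector (u_eigen (k n0)).
  have [c [dX eX] cm] := aug_mode_defect S_sqrt Bs_adjoint alpha_gt0 alpha_lt1
    eta_ge0 w0 Au AuE hh.
  have X1 : wave_dot (wave_mode (omega (k n0)) (u (k n0)))
      (wave_mode (omega (k n0)) (u (k n0))) = 1 by rewrite u_basis.1 eqxx.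
  apply: (le_trans (aug_mode_norm_ge1 Bs eta alpha_gt0 alpha_lt1 X1)).
  apply: (le_trans (res (omega (k n0)) _ dX)); rewrite eX [N _]energy_norm_pivot.
  have hC' : rnorm h <= `|C| by apply: le_trans hC (ler_norm _).
  have := ler_pM (normc_ge0 c) (rnorm_ge0 h) (cm m mw) hC'.
  rewrite rnormZc normcM normcR (ger0_norm g0) /K.
  move: (gamma alpha) g0 => g g0 hch.
  have -> : M * (g * 2 * `|C|) * decay alpha m =
    M * (g * (2 * decay alpha m * `|C|)) by ring.
  by rewrite ler_wpM2l// -mulrA ler_wpM2l.
have lim : K * decay alpha m @[m --> \oo] --> (0 : R).
  by rewrite -[X in _ --> X](mulr0 K); apply: cvgMl_tmp; exact: cvg_decay.
have : (1 : R) <= 0.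
  by apply: (ler_cvg_to (cvg_cst _) lim); apply: nearW => m; exact: step.
by rewrite ler10.
Qed.

Lemma rnorm_mode_le1 n : rnorm (half_val (u n)) <= 1.
Proof.
have := u_basis.1 n n; rewrite eqxx => /(congr1 (fun a : R[i] => complex.Re a)).
rewrite Re_wave_dotxx /= => e.
rewrite -(@ler_pXn2r _ 2) ?nnegrE ?rnorm_ge0// expr1n -e.
by rewrite lerDr sqr_ge0.
Qed.

(** When B is bounded into H, so is B B^*, because
    |B^* u|^2 = <B B^* u, u> <= C |B^* u| |u|. *)
Lemma not_exponentially_stable_of_bounded_in_pivot :
  bounded_in_pivot B -> ~ exponentially_stable N etA.
Proof.
move=> [B0 [C BC] rB].
apply: (@not_exponentially_stable_of_bounded id (`|C| * `|C|)) => // n.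
exists (B0 (Bs (u n))); first exact: rB.
have C1 x : rnorm (B0 x) <= `|C| * rnorm x.
  by apply: (le_trans (BC x)); rewrite ler_wpM2r ?rnorm_ge0// ler_norm.
apply: (le_trans (C1 _)); rewrite ler_wpM2l//.
have e : rnorm (Bs (u n)) ^+ 2 = complex.Re (dot (B0 (Bs (u n))) (half_val (u n))).
  by rewrite -Re_dotxx -Bs_adjoint rB.
have h1 : rnorm (Bs (u n)) ^+ 2 <= `|C| * rnorm (Bs (u n)).
  rewrite e; apply: (le_trans (ler_norm _)); apply: (le_trans (Re_dot_le _ _)).
  apply: (le_trans _ (C1 _)).
  by rewrite ler_piMr ?rnorm_ge0// rnorm_mode_le1.
have [->|b0] := eqVneq (rnorm (Bs (u n))) 0; first by [].
by rewrite expr2 ler_pM2r// lt0r b0 rnorm_ge0 in h1.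
Qed.

(** An eigenvector for i w is determined by its coordinates on the finitely many
    wave modes with |omega n| < |w| + 1: it is orthogonal to all the others, and
    its diffusive component is a function of its wave component. *)
Lemma aug_eigenspace_isometry (w : R) t : w != 0 -> 0 <= t ->
  forall X, op_eigenspace (augmented_op B Bs alpha eta) w X -> N (etA t X) = N X.
Proof.
move=> w0 t0.
have [n0 hn0] := omega_large (`|w| + 1).
pose F n (X : energy_space U S) := wave_dot X.1 (wave_mode (omega n) (u n)).
pose L n := rnorm (S (half_val (wave_mode (omega n) (u n)).1)) +
  rnorm (wave_mode (omega n) (u n)).2.
apply: (eigenspace_isometry snN sgT genT (c := F) (L := L) (n := n0)) => //.
- by move=> n a X Y; exact: wave_dot_lin.
- move=> n X; rewrite /F /wave_dot /half_dot; apply: (le_trans (le_normcD _ _)).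
  rewrite /L mulrDl; apply: lerD; apply: (le_trans (normc_dot_le _ _)); rewrite mulrC.
    by rewrite ler_wpM2l ?rnorm_ge0//; exact: rnorm_half_le.
  by rewrite ler_wpM2l ?rnorm_ge0//; exact: rnorm_pivot_le.
move=> X [dX eX] cX.
have [Au AuE vE phiE] := aug_eigenvector S_sqrt Bs_adjoint eta_ge0 w0 dX eX.
have X1E : X.1 = (X.1.1, (0 +i* w) *: half_val X.1.1).
  by rewrite -vE; case: (X.1).
have X1_0 : rnorm (S (half_val X.1.1)) ^+ 2 + rnorm X.1.2 ^+ 2 = 0.
  apply: (orthogonal_basis_eq0 u_basis) => n.
  have [nn0|nn0] := ltnP n n0.
    exact: cX.
  have [_ Aun AunE] := wave_eigenvector (u_eigen n).
  rewrite X1E; apply: (wave_dot_eigen_neq S_sqrt _ Au AuE Aun AunE).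
  by apply: (lt_le_trans _ (hn0 n nn0)); rewrite ltrDl.
have v0 : X.1.2 = 0.
  apply: rnorm_eq0; apply/eqP; rewrite -sqrf_eq0 eq_le sqr_ge0 andbT.
  by rewrite -X1_0 lerDr sqr_ge0.
have b0 : Bs (to_half S X.1.2) = 0.
  have -> : to_half S X.1.2 = 0; last exact: adjoint0 Bs_adjoint.
  by rewrite v0 -[0 in LHS]/(half_val (0 : half_space S)) to_half_val.
have phi0 : L2sq mu (repr X.2) = 0.
  apply: L2sq_null; last exact: strongly_measurable_repr.
  by apply: filterS phiE => x ->; rewrite b0 /profile !scaler0.
by rewrite /N energy_normE /energy_sq phi0 mulr0 addr0 X1_0 sqrtr0.
Qed.

(** When B^* u_n = 0 the defect of the quasimode is 0. *)
Lemma unobserved_mode n : Bs (u n) = 0 ->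
  exists X : energy_space U S,
    op_eigenspace (augmented_op B Bs alpha eta) (omega n) X /\ 1 <= N X.
Proof.
move=> b0.
have B0 : represents (0 : H) (B (Bs (u n))).
  by move=> z; rewrite Bs_adjoint b0 !dot0l.
have [w0 Au AuE] := wave_eigenvector (u_eigen n).
have [c [dX eX] _] := aug_mode_defect S_sqrt Bs_adjoint alpha_gt0 alpha_lt1
  eta_ge0 w0 Au AuE B0.
exists (aug_mode Bs alpha eta (omega n) (u n)); split.
  split => //; apply/esym/eqP; rewrite -subr_eq0 eX scaler0.
  by [].
apply: aug_mode_norm_ge1 => //.
by rewrite u_basis.1 eqxx.
Qed.

End Stability.

(** * The stability theorem *)

Theorem theorem5p1 (R : realType) (H U : hilbertType R)
  (A : linear_op H H) (A_sa : selfadjoint A) (A_pos : strictly_positive A)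
  (sqrtA : linear_op H H) (sqrtA_sqrt : is_sqrt_op A sqrtA)
  (B : {linear U -> dual_half_space sqrtA}) (B_bounded : bounded_to_dual B)
  (Bs : half_space sqrtA -> U) (Bs_adjoint : is_adjoint B Bs)
  (alpha eta : R) (alpha_gt0 : 0 < alpha) (alpha_lt1 : alpha < 1)
  (eta_ge0 : 0 <= eta)
  (etA : R -> {linear energy_space U sqrtA -> energy_space U sqrtA})
  (etA_semigroup : C0_semigroup (energy_norm alpha) etA)
  (etA_generated :
     generated_by (energy_norm alpha) etA (augmented_op B Bs alpha eta))
  (H_infinite : infinite_dimensional H)
  (H_compact : compact_embedding sqrtA)
  (omega : nat -> R) (u : nat -> half_space sqrtA)
  (omega_infty : `|omega n| @[n --> \oo] --> +oo)
  (u_eigen : forall n, is_eigenvector (wave_op A sqrtA) (0 +i* omega n)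
                         (wave_mode (omega n) (u n)))
  (u_basis : orthonormal_basis (fun n => wave_mode (omega n) (u n))) :
  (bounded_in_pivot B -> ~ exponentially_stable (energy_norm alpha) etA)
  /\
  ((exists n, Bs (u n) = 0) ->
     [/\ ~ exponentially_stable (energy_norm alpha) etA,
         ~ strongly_stable (energy_norm alpha) etA
       & exists2 X0 : energy_space U sqrtA, X0 <> 0 &
           forall t, 0 <= t -> energy alpha (etA t X0) = energy alpha X0])
  /\
  ((forall n, Bs (u n) <> 0) ->
   (exists (k : nat -> nat) (C : R),
      [/\ {homo k : m n / (m < n)%N}, 0 < C
        & forall n, exists2 h : H, represents h (B (Bs (u (k n)))) &
                                   rnorm h <= C]) ->
   ~ exponentially_stable (energy_norm alpha) etA).
Proof.
have snN := @seminorm_energy R H U sqrtA alpha alpha_gt0 alpha_lt1.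
split; last split.
- exact: (not_exponentially_stable_of_bounded_in_pivot sqrtA_sqrt Bs_adjoint
    alpha_gt0 alpha_lt1 eta_ge0 etA_semigroup etA_generated omega_infty
    u_eigen u_basis).
- move=> [n bn0].
  have [w0 _ _] := wave_eigenvector (u_eigen n).
  have [X [KX X1]] := unobserved_mode sqrtA_sqrt Bs_adjoint alpha_gt0 alpha_lt1
    eta_ge0 u_eigen u_basis bn0.
  have iso t : 0 <= t -> energy_norm alpha (etA t X) = energy_norm alpha X.
    by move=> t0; exact: (aug_eigenspace_isometry sqrtA_sqrt Bs_adjoint alpha_gt0
      alpha_lt1 eta_ge0 etA_semigroup etA_generated omega_infty u_eigen u_basis
      w0 t0 KX).
  split.
  + move=> /(exponentially_stable_resolvent snN etA_semigroup etA_generated).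
    move=> [M _ /(_ (omega n) X KX.1)].
    rewrite KX.2 subrr (sn0 snN) mulr0 => X0.
    by have := le_trans X1 X0; rewrite ler10.
  + move=> /(_ X) X0.
    have X0' : energy_norm alpha X <= 0.
      apply: (ler_cvg_to (cvg_cst _) X0); near=> t.
      by rewrite iso//; near: t; exact: nbhs_pinfty_ge.
    by have := le_trans X1 X0'; rewrite ler10.
  exists X; last by move=> t t0; rewrite /energy iso.
  by move=> X0; move: X1; rewrite X0 (sn0 snN) ler10.
- move=> _ [k [C [kmono _ hk]]].
  exact: (not_exponentially_stable_of_bounded sqrtA_sqrt Bs_adjoint alpha_gt0
    alpha_lt1 eta_ge0 etA_semigroup etA_generated omega_infty u_eigen u_basis
    kmono hk).
Unshelve. all: by end_near. Qed.
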